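(* Let $S$ be a square. Up to symmetries of $S$, there are only two (that is, exactly two) proper perfect Mondrian $8$-partitions of $S$.
   Context: All rectangles have real side lengths. Two rectangles are congruent, written $R_1\cong R_2$, if the lengths of their sides (not necessarily in the same order) are equal. A $k$-partition ($k\ge 2$) of a rectangle $R$ is a tiling of $R$ by $k$ rectangles $R_1,\dots,R_k$. A partition $\{R_1,\dots,R_k\}$ of $R$ is a Mondrian partition if $R_i\not\cong R_j$ for all $i\ne j$. A Mondrian partition is perfect if $\mathrm{area}(R_i)=\frac1k\,\mathrm{area}(R)$ for every $i$. A partition $\mathcal{P}=\{R_1,\dots,R_k\}$ of $R$ is proper if there is no subset $\mathcal{P}'\subset\mathcal{P}$ with $1<|\mathcal{P}'|<k$ whose members form (i.e., have union equal to) a rectangle $R'$ contained in $R$. ''Up to symmetries'' means that partitions obtained from each other by a symmetry (rotation or reflection) of the square are identified. *)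

(* Defs.v *)
From mathcomp Require Import all_boot all_order all_algebra all_fingroup.
From mathcomp Require Import classical_sets reals topology normedtype.

Set Implicit Arguments.
Unset Strict Implicit.
Unset Printing Implicit Defensive.

Import Order.TTheory GRing.Theory Num.Theory numFieldNormedType.Exports.

Local Open Scope classical_set_scope.
Local Open Scope ring_scope.

(* The norm of R * R in MathComp-Analysis is the sup norm. *)
Definition euclidean_dist (R : realType) (p q : R * R) : R :=
  Num.sqrt ((p.1 - q.1) ^+ 2 + (p.2 - q.2) ^+ 2).

(* A nondegenerate rectangle, in any position: its sides issued from [corner]
   are width * (c, s) and height * (- s, c), where [direction] = (c, s) is a
   unit vector. Several records describe the same subset of the plane, so
   rectangles are identified through [points] below. *)
Record rectangle (R : realType) := Rectangle {
  corner : R * R;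
  direction : R * R;
  width : R;
  height : R;
  direction_unit : direction.1 ^+ 2 + direction.2 ^+ 2 = 1;
  width_gt0 : 0 < width;
  height_gt0 : 0 < height
}.

Definition points (R : realType) (A : rectangle R) : set (R * R) :=
  [set p | exists a b, [/\ 0 <= a <= width A, 0 <= b <= height A &
    p = ((corner A).1 + a * (direction A).1 - b * (direction A).2,
         (corner A).2 + a * (direction A).2 + b * (direction A).1)]].

Definition area (R : realType) (A : rectangle R) : R := width A * height A.

Definition is_square (R : realType) (A : rectangle R) : Prop :=
  width A = height A.

Definition congruent (R : realType) (A B : rectangle R) : Prop :=
  (width A = width B /\ height A = height B) \/
  (width A = height B /\ height A = width B).

(* The tiles of a k-partition are indexed by 'I_k; tiles with distinct indices
   are distinct sets because their (nonempty) interiors are disjoint. *)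
Definition partition_of (R : realType) (S : rectangle R) (k : nat)
    (P : 'I_k -> rectangle R) : Prop :=
  \bigcup_i points (P i) = points S /\
  (forall i j : 'I_k, i != j -> (points (P i))° `&` (points (P j))° = set0).

Definition mondrian (R : realType) (k : nat) (P : 'I_k -> rectangle R) : Prop :=
  forall i j : 'I_k, i != j -> ~ congruent (P i) (P j).

Definition perfect (R : realType) (S : rectangle R) (k : nat)
    (P : 'I_k -> rectangle R) : Prop :=
  forall i : 'I_k, area (P i) = k%:R^-1 * area S.

Definition proper_partition (R : realType) (S : rectangle R) (k : nat)
    (P : 'I_k -> rectangle R) : Prop :=
  ~ exists A : {set 'I_k}, (1 < #|A| < k)%N /\
      exists B : rectangle R, points B `<=` points S /\
        \bigcup_(i in [set` A]) points (P i) = points B.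

Definition proper_perfect_mondrian_partition (R : realType) (S : rectangle R)
    (k : nat) (P : 'I_k -> rectangle R) : Prop :=
  [/\ partition_of S P, mondrian P, perfect S P & proper_partition S P].

(* A plane isometry mapping S onto itself; for a square S these are the four
   rotations and the four reflections of S. *)
Definition symmetry_of (R : realType) (S : rectangle R)
    (f : R * R -> R * R) : Prop :=
  (forall p q, euclidean_dist (f p) (f q) = euclidean_dist p q) /\
  f @` points S = points S.

(* f sends the set of tiles of P onto the set of tiles of Q, whatever the
   orders in which the two partitions list their tiles. *)
Definition same_up_to_symmetry (R : realType) (S : rectangle R) (k : nat)
    (P Q : 'I_k -> rectangle R) : Prop :=
  exists f : R * R -> R * R, symmetry_of S f /\
    exists s : 'S_k, forall i : 'I_k, f @` points (P i) = points (Q (s i)).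

(* Main.v *)
Require Import Defs.
From mathcomp Require Import all_boot all_order all_algebra all_fingroup ring lra.
From mathcomp Require Import classical_sets reals topology normedtype.

Set Implicit Arguments.
Unset Strict Implicit.
Unset Printing Implicit Defensive.

Import Order.TTheory GRing.Theory Num.Theory numFieldNormedType.Exports.

(** The proof reduces the theorem to a finite search over combinatorial types of
tilings, and then compares tilings of the same type by a rigidity argument that
avoids solving equations, except to exhibit the two solutions.

Geometry. In a tiling of a rectangle by rectangles every tile is parallel to the
big rectangle ([tiles_aligned]). Otherwise take, among the tilted tiles, one whose
lowest corner v is lowest. Just below its right-hand side near v lies a point of
another tile that also contains v; that tile cannot reach below v if it is tilted,
and in all cases its interior meets the interior of the first one ([no_tilt]). So
a partition of the square is a family of boxes [l, r] x [b, t] in the frame of S.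

Combinatorics. A box tiling is swept from the bottom: the tiles already placed lie
below a staircase, and at a valley of the staircase one tile sits in the left-hand
corner ([valley_tile]). Symbols stand for the abscissas and ordinates; each step
branches on finitely many order relations, and a branch is dropped as soon as two
tiles share a side, since they would form a rectangle. Hence every tiling realises a
leaf of a finite tree ([start_sound]). Evaluation of the tree ([search_recognised])
shows that each leaf either contains a rectangle made of several tiles, or becomes,
after one of the eight symmetries of the square, an instance of one of four explicit
types.

Rigidity. At each corner point of a tiling the contributions of the tiles cancel, so
the sum of the areas (x_r - x_l)(y_t - y_b) is a bilinear identity that holds for any
values of the symbols ([corner_sum]). Apply it to the difference of two realisations
of one type in the same square: the sum of (w - w')(h - h') over the tiles is 0. When
w h = w' h' each term is nonpositive, so w = w' and h = h' for each tile ([rigid]).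
Thus a type has at most one realisation with equal areas. Two of the four types are
symmetric (under a half-turn, or a reflection), and rigidity applied to the
realisation and its image produces two congruent tiles, which is excluded. The other
two types give at most one partition each up to symmetry.

Existence. The equal-area equations of the two remaining types are the same, and
reduce to one quartic in the ordinate p of the top of the first tile; it has a root
near 0.85208 and a root near 0.83176, and the orders of the coordinates at these
roots are those of the first and of the second type ([solution_first],
[solution_second]). The eight half-perimeters are distinct, so no two tiles are
congruent. No proper subfamily forms a rectangle: for each of the subsets a tile
outside it meets the interior of its bounding box ([model_unmergeable]). Finally the
first partition has a tile with a longer diagonal than all tiles of the second, so
no isometry maps one partition to the other. *)

(** * Symbolic tilings and the sweep *)

(** A box [l, r] x [b, t] is the pair of its two intervals ((l, r), (b, t)). *)
Definition box (T : Type) : Type := ((T * T) * (T * T))%type.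

Definition quad (l r b t : nat) : box nat := ((l, r), (b, t)).

Definition map_box (T U : Type) (f g : T -> U) (q : box T) : box U :=
  ((f q.1.1, f q.1.2), (g q.2.1, g q.2.2)).

(** A stage of the sweep. Natural numbers are symbols for abscissas and for
ordinates; in both cases 0 and 1 denote the two walls of the square. A step (a, h) of
the staircase starts at abscissa a, has height h, and ends where the next step
starts; [lefts] are the steps before [focus], the nearest first, and [rights] those
after it. A fact (h, k) records that h < k, and the symbols from [fresh] on are
unused. *)
Record state := State {
  tiles : seq (box nat);
  lefts : seq (nat * nat);
  focus : nat * nat;
  rights : seq (nat * nat);
  facts : seq (nat * nat);
  fresh : nat
}.

(** Identifies the ordinate a with the ordinate b. *)
Definition redirect (a b s : nat) : nat := if s == a then b else s.

Definition redirect_state (a b : nat) (st : state) : state :=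
  let f := redirect a b in
  let g (s : nat * nat) := (s.1, f s.2) in
  State (map (map_box id f) (tiles st)) (map g (lefts st)) (g (focus st))
    (map g (rights st)) (map (fun s => (f s.1, f s.2)) (facts st)) (fresh st).

(** The order relations between two ordinates that the facts do not exclude. *)
Definition may_lt (F : seq (nat * nat)) (a b : nat) : bool :=
  (a != b) && ((b, a) \notin F).
Definition may_eq (F : seq (nat * nat)) (a b : nat) : bool :=
  (a == b) || ((a, b) \notin F) && ((b, a) \notin F).

(** The top of q is the bottom of r, or the right side of q is the left side of r. *)
Definition share_side (T : eqType) (q r : box T) : bool :=
  [&& q.1.1 == r.1.1, q.1.2 == r.1.2 & q.2.2 == r.2.1] ||
  [&& q.2.1 == r.2.1, q.2.2 == r.2.2 & q.1.2 == r.1.1].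

Definition mergeable (ts : seq (box nat)) : bool :=
  has (fun q => has (share_side q) ts) ts.

(** The sweep is a conjunction over all branches of the test [leaf] at the leaves.
Conditionals are used instead of boolean implications because their branches are
evaluated on demand also under call by value. *)
Section Search.
Variable leaf : seq (box nat) -> bool.

(** Compares the focused step with the step on its left. *)
Definition settle (rec : state -> bool) (st : state) : bool :=
  if lefts st is l :: ls then
    let h := (focus st).2 in
    [&& if may_lt (facts st) h l.2 then
          rec (State (tiles st) (lefts st) (focus st) (rights st)
                 ((h, l.2) :: facts st) (fresh st)) else true,
        if may_lt (facts st) l.2 h then
          rec (State (tiles st) ls l (focus st :: rights st)
                 ((l.2, h) :: facts st) (fresh st)) else true &
        if may_eq (facts st) h l.2 then
          rec (redirect_state h l.2
            (State (tiles st) ls l (rights st) (facts st) (fresh st)))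
        else true]
  else rec st.

(** Puts a tile into the left corner of the focused step, which is a valley. The tile
either fills the valley or ends at a fresh abscissa. *)
Definition place (rec : state -> bool) (st : state) : bool :=
  let: (a, h) := focus st in
  let n := fresh st in
  if size (tiles st) < 8 then
    let b := if rights st is x :: _ then x.1 else 1 in
    settle rec (State (((a, b), (h, n)) :: tiles st) (lefts st) (a, n) (rights st)
                  ((h, n) :: facts st) n.+1) &&
    settle rec (State (((a, n), (h, n)) :: tiles st) (lefts st) (a, n)
                  ((n, h) :: rights st) ((h, n) :: facts st) n.+1)
  else if (lefts st, rights st) is ([::], [::]) then
    leaf (map (map_box id (redirect h 1)) (tiles st))
  else true.

(** Compares the focused step with the step on its right. *)
Definition scan (rec : state -> bool) (st : state) : bool :=
  if mergeable (tiles st) then true else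
  if rights st is x :: xs then
    let: (a, h) := focus st in
    [&& if may_lt (facts st) x.2 h then
          rec (State (tiles st) (focus st :: lefts st) x xs
                 ((x.2, h) :: facts st) (fresh st)) else true,
        if may_eq (facts st) x.2 h then
          rec (redirect_state x.2 h
            (State (tiles st) (lefts st) (focus st) xs (facts st) (fresh st)))
        else true &
        if may_lt (facts st) h x.2 then
          place rec (State (tiles st) (lefts st) (focus st) (rights st)
                 ((h, x.2) :: facts st) (fresh st)) else true]
  else place rec st.

Fixpoint search (fuel : nat) (st : state) : bool :=
  if fuel is fuel'.+1 then scan (search fuel') st else false.
End Search.

Definition start : state := State [::] [::] (0, 0) [::] [::] 2.

(** There is a path of at most [fuel] edges of F from a to b. *)
Fixpoint below (fuel : nat) (F : seq (nat * nat)) (a b : nat) : bool :=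
  if a == b then true else
  if fuel is f.+1 then
    has (fun e => if e.1 == a then below f F e.2 b else false) F
  else false.

(** Some box, spanned by the lower left corner of a tile and the upper right corner
of another, contains or avoids each tile and contains between two and seven of them.
The order of the symbols is the one generated by the sides of the tiles. *)
Definition improper (ts : seq (box nat)) : bool :=
  let lex := below 8 (map fst ts) in
  let ley := below 8 (map snd ts) in
  let inside (q r : box nat) :=
    [&& lex q.1.1 r.1.1, lex r.1.2 q.1.2, ley q.2.1 r.2.1 & ley r.2.2 q.2.2] in
  let outside (q r : box nat) :=
    [|| lex r.1.2 q.1.1, lex q.1.2 r.1.1, ley r.2.2 q.2.1 | ley q.2.2 r.2.1] in
  let cand q :=
    all (fun r => inside q r || outside q r) ts && (1 < count (inside q) ts < 8) in
  has (fun q => has (fun r => cand ((q.1.1, r.1.2), (q.2.1, r.2.2))) ts) ts.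

(** The four types. Abscissas are 0, ..., 5 and ordinates 0, ..., 4, where the walls
are 0 and 5, and 0 and 4. For the first and the second type the numbering is that of
the increasing order of the coordinates in the solution. *)
Definition first_type : seq (box nat) :=
  [:: quad 0 1 0 3; quad 1 2 0 2; quad 2 5 0 1; quad 2 3 1 2;
      quad 3 4 1 3; quad 1 3 2 3; quad 4 5 1 4; quad 0 4 3 4].
Definition second_type : seq (box nat) :=
  [:: quad 0 1 0 3; quad 1 4 0 1; quad 4 5 0 2; quad 1 2 1 3;
      quad 2 4 1 2; quad 2 3 2 3; quad 3 5 2 4; quad 0 3 3 4].
Definition half_turn_type : seq (box nat) :=
  [:: quad 0 2 0 2; quad 2 3 0 3; quad 3 5 0 1; quad 3 4 1 3;
      quad 4 5 1 4; quad 2 1 3 2; quad 1 4 3 4; quad 0 1 2 4].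
Definition mirror_type : seq (box nat) :=
  [:: quad 0 2 0 2; quad 2 3 0 3; quad 3 5 0 1; quad 2 4 3 2;
      quad 4 1 3 4; quad 0 4 2 4; quad 1 3 3 1; quad 1 5 1 4].

Definition types := [:: first_type; half_turn_type; mirror_type; second_type].

(** Partial renamings of symbols; [bind] adds the requirement that s becomes v. *)
Definition bind (f : seq (option nat)) (s v : nat) : option (seq (option nat)) :=
  match nth None f s with
  | None => Some (set_nth None f s (Some v))
  | Some w => if w == v then Some f else None
  end.

(** Looks for a renaming of the symbols of m that sends each box of m into ts. No
specification is needed: [fits] checks the outcome. *)
Fixpoint assign (m ts : seq (box nat)) (fx fy : seq (option nat)) :
    option (seq (option nat) * seq (option nat)) :=
  if m is q :: m' then
    (fix try (us : seq (box nat)) := if us is u :: us' then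
       let next :=
         if bind fx q.1.1 u.1.1 is Some fx1 then
         if bind fx1 q.1.2 u.1.2 is Some fx2 then
         if bind fy q.2.1 u.2.1 is Some fy1 then
         if bind fy1 q.2.2 u.2.2 is Some fy2 then assign m' ts fx2 fy2
         else None else None else None else None in
       if next is Some r then Some r else try us' else None) ts
  else Some (fx, fy).

Definition rename (f : seq (option nat)) (s : nat) : nat := odflt 0 (nth None f s).

(** The arrangement ts is an instance of the type m, by a renaming of the symbols that
respects the walls. The renaming need not be injective, so that arrangements in which
four tiles meet at a point are instances as well. *)
Definition fits (m ts : seq (box nat)) : bool :=
  if assign m ts [:: Some 0; None; None; None; None; Some 1]
       [:: Some 0; None; None; None; Some 1] is Some (fx, fy) then
    [&& rename fx 0 == 0, rename fx 5 == 1, rename fy 0 == 0, rename fy 4 == 1 &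
      perm_eq (map (map_box (rename fx) (rename fy)) m) ts]
  else false.

(** A triple of booleans encodes a symmetry of the square: whether to reflect the
abscissas, whether to reflect the ordinates, and then whether to exchange the two. The
reflection f of the coordinates is [mirror] on the symbols of the sweep. *)
Definition mirror (s : nat) : nat := match s with 0 => 1 | 1 => 0 | _ => s end.

Definition flip_interval T (f : T -> T) (i : T * T) : T * T := (f i.2, f i.1).

Definition move_box T (f : T -> T) (g : bool * bool * bool) (q : box T) : box T :=
  let q1 := if g.1.1 then (flip_interval f q.1, q.2) else q in
  let q2 := if g.1.2 then (q1.1, flip_interval f q1.2) else q1 in
  if g.2 then (q2.2, q2.1) else q2.

Definition moves : seq (bool * bool * bool) :=
  [seq (ab, c) | ab <- [seq (a, b) | a <- [:: false; true], b <- [:: false; true]],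
                 c <- [:: false; true]].

(** The arrangement contains a rectangle made of several tiles, or is an instance of one
of the types up to a symmetry. *)
Definition recognised (ts : seq (box nat)) : bool :=
  if improper ts then true else
  has (fun g => has (fun m => fits m (map (move_box mirror g) ts)) types) moves.

(** The search returns false when it runs out of fuel, so the tree has depth at most 17. *)
Lemma search_recognised : search recognised 17 start.
Proof. by vm_compute. Qed.

(** ** The two proper types as tilings of a grid *)

Definition nat_overlap (q r : box nat) : bool :=
  [&& q.1.1 < r.1.2, r.1.1 < q.1.2, q.2.1 < r.2.2 & r.2.1 < q.2.2].

Definition tile (m : seq (box nat)) (k : nat) : box nat := nth (quad 0 0 0 0) m k.

(** The boxes of m tile the grid of 5 by 4 unit cells. *)
Definition grid_tiled (m : seq (box nat)) : bool :=
  [&& size m == 8,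
      all (fun q : box nat => (q.1.1 < q.1.2 <= 5) && (q.2.1 < q.2.2 <= 4)) m,
      all (fun i => all (fun j => has (fun q : box nat =>
        [&& q.1.1 <= i, i < q.1.2, q.2.1 <= j & j < q.2.2]) m) (iota 0 4)) (iota 0 5) &
      all (fun k => all (fun l => (k == l) || ~~ nat_overlap (tile m k) (tile m l))
        (iota 0 8)) (iota 0 8)].

Fixpoint masks (n : nat) : seq (seq bool) :=
  if n is n'.+1 then map (cons true) (masks n') ++ map (cons false) (masks n')
  else [:: [::]].

Lemma mem_masks (s : seq bool) : s \in masks (size s).
Proof.
elim: s => //= b s IH; rewrite mem_cat.
by case: b; rewrite map_f ?orbT.
Qed.

(** Some box of m not selected by the mask s meets the interior of the bounding box of
the selected ones. *)
Definition spread (m : seq (box nat)) (s : seq bool) : bool :=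
  let sel := mask s m in
  has (fun q => [&& has (fun r : box nat => q.1.1 < r.1.2) sel,
    has (fun r : box nat => r.1.1 < q.1.2) sel,
    has (fun r : box nat => q.2.1 < r.2.2) sel &
    has (fun r : box nat => r.2.1 < q.2.2) sel]) (mask (map negb s) m).

Definition unmergeable (m : seq (box nat)) : bool :=
  all (fun s => (1 < count id s < 8) ==> spread m s) (masks 8).

Lemma first_type_grid : grid_tiled first_type && unmergeable first_type.
Proof. by vm_compute. Qed.

Lemma second_type_grid : grid_tiled second_type && unmergeable second_type.
Proof. by vm_compute. Qed.

Local Open Scope ring_scope.

(** * Box tilings and soundness of the sweep *)

Section Sound.
Variables (R : realFieldType) (I : finType) (W H : R) (X : I -> box R).

(** The open boxes meet. *)
Definition overlap (q r : box R) : bool :=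
  [&& q.1.1 < r.1.2, r.1.1 < q.1.2, q.2.1 < r.2.2 & r.2.1 < q.2.2].

Definition within (q : box R) : bool :=
  [&& 0 <= q.1.1, q.1.1 < q.1.2, q.1.2 <= W, 0 <= q.2.1, q.2.1 < q.2.2 & q.2.2 <= H].

(** Membership in [l, r[ x [b, t[. With half-open tiles a tiling is a partition, so that no
limit argument is needed during the sweep. *)
Definition half_open (q : box R) (x y : R) : bool :=
  [&& q.1.1 <= x, x < q.1.2, q.2.1 <= y & y < q.2.2].

(** The boxes X i tile the rectangle [0, W] x [0, H]. *)
Definition box_tiling : Prop :=
  [/\ forall i, within (X i),
      forall x y, 0 <= x < W -> 0 <= y < H -> exists i, half_open (X i) x y &
      forall i j, i != j -> ~~ overlap (X i) (X j)].

(** A step of the staircase over [a, b] at height h, where p selects the placed tiles: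
placed tiles over ]a, b[ lie below h, the others above. *)
Definition step (p : pred I) (a b h : R) : Prop :=
  [/\ a < b, 0 <= h <= H & forall i, (X i).1.1 < b -> a < (X i).1.2 ->
      if p i then (X i).2.2 <= h else h <= (X i).2.1].

Fixpoint steps_left (p : pred I) (ls : seq (R * R)) (b : R) : Prop :=
  if ls is s :: ls' then step p s.1 b s.2 /\ steps_left p ls' s.1 else b = 0.

Fixpoint steps_right (p : pred I) (s : R * R) (rs : seq (R * R)) : Prop :=
  if rs is t :: rs' then step p s.1 t.1 s.2 /\ steps_right p t rs'
  else step p s.1 W s.2.

Definition lower (s t : R * R) : bool := s.2 < t.2.

Hypothesis tilX : box_tiling.

Lemma withinX i : within (X i). Proof. by case: tilX. Qed.

Lemma step_cat p a b c h : step p a b h -> step p b c h -> step p a c h.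
Proof.
move=> [ab hH ph] [bc _ ph']; split=> // [|i lc ar]; first exact: lt_trans bc.
case: (ltP (X i).1.1 b) => [lb|bl]; first exact: ph.
apply: ph' => //; apply: le_lt_trans bl _.
by case/and5P: (withinX i).
Qed.

Lemma step_add (p : pred I) i a b h :
  ((X i).1.2 <= a) || (b <= (X i).1.1) -> step p a b h -> step (predU1 i p) a b h.
Proof.
move=> out [ab hH ph]; split=> // j lb ar; rewrite /= /predU1 /=.
case: eqVneq => [eji|_] /=; last exact: ph.
by subst j; case/orP: out => out; lra.
Qed.

(** Placing the tile i in the left corner of a step raises the step above i; the next lemma
describes what remains of it. *)
Lemma step_raise (p : pred I) i a e h : step p a e h -> ~~ p i ->
  (X i).1.1 = a -> (X i).1.2 <= e -> (X i).2.1 = h ->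
  step (predU1 i p) a (X i).1.2 (X i).2.2.
Proof.
move=> [ae /andP[h0 hH] ph] pi li ri bi.
have /and5P[l0 lr rW b0 /andP[bt tH]] := withinX i.
split=> [||j lj rj]; [lra | apply/andP; split; lra |].
rewrite /= /predU1 /=; case: eqVneq => [->|ji] //=.
have := ph j; have -> : (X j).1.1 < e by apply: lt_le_trans ri.
rewrite rj => /(_ isT isT).
case: tilX => _ _ /(_ j i ji) /negP na; have /and5P[_ _ _ _ /andP[btj _]] := withinX j.
case: (p j) => hj; first by lra.
rewrite leNgt; apply/negP => tj; apply: na.
by apply/and4P; split; lra.
Qed.

Lemma step_rest (p : pred I) i a e h : step p a e h -> a <= (X i).1.2 -> (X i).1.2 < e ->
  step (predU1 i p) (X i).1.2 e h.
Proof.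
move=> [ae hH ph] ai ie; apply: step_add; first by rewrite lexx.
by split=> // j lj rj; apply: ph => //; lra.
Qed.

Lemma steps_left_add (p : pred I) i ls b : b <= (X i).1.1 ->
  steps_left p ls b -> steps_left (predU1 i p) ls b.
Proof.
elim: ls b => //= s ls IH b bi [st sl]; split; first by apply: step_add; rewrite ?bi ?orbT.
by apply: IH sl; case: st => sb _ _; lra.
Qed.

Lemma steps_right_add (p : pred I) i s rs : (X i).1.2 <= s.1 ->
  steps_right p s rs -> steps_right (predU1 i p) s rs.
Proof.
elim: rs s => //= [s si st|t rs IH s si [st sr]]; first by apply: step_add; rewrite ?si.
split; first by apply: step_add; rewrite ?si.
by apply: IH sr; case: st => sb _ _; lra.
Qed.

(** The abscissa where the step before rs ends. *)
Definition end_of (rs : seq (R * R)) : R := if rs is t :: _ then t.1 else W.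

(** The key fact of the sweep: at a valley below the top of the square, the tile that
contains the left corner starts there and does not reach beyond the valley, since the
neighbouring steps are higher. *)
Lemma valley_tile (p : pred I) ls s rs :
  s.2 < H ->
  steps_left p ls s.1 -> path lower s ls -> steps_right p s rs ->
  (if rs is t :: _ then lower s t else true) ->
  exists i, [/\ ~~ p i, (X i).1.1 = s.1, (X i).1.2 <= end_of rs & (X i).2.1 = s.2].
Proof.
move=> hH sl pl sr lr.
have [ste sw] : step p s.1 (end_of rs) s.2 /\ end_of rs <= W.
  case: rs sr {lr} => [|t rs] /=; first by split.
  case=> [st sr]; split => //.
  elim: rs t sr {st} => [|u rs IH] t /=; first by case=> /ltW.
  by case=> [[/ltW tu _ _]] /IH; apply: le_trans.
have s0 : 0 <= s.1.
  elim: ls s.1 sl {pl lr sr ste} => [|t ls IH] b /=; first by move=> ->.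
  by case=> [[/ltW tb _ _]] /IH; move=> t0; apply: le_trans tb.
have [ab /andP[h0 _] ph] := ste.
have [_ cov _] := tilX.
have [||i /and4P[lx xr ly yr]] := cov s.1 s.2; [lra|lra|].
have pi : ~~ p i.
  apply/negP => pi; have := ph i; rewrite pi => /(_ _ xr).
  by move=> /(_ ltac:(lra)); lra.
exists i; split=> //.
- case: ls sl pl => [|t ls] /=; first by have := withinX i => /and5P[? _ _ _ _] ? _; lra.
  move=> [[ts _ pt] _] /andP[st _]; apply/eqP; rewrite eq_le lx /=.
  rewrite leNgt; apply/negP => ls'; have := pt i ls' ltac:(lra).
  by rewrite (negbTE pi); rewrite /lower in st; lra.
- case: rs sr lr ste sw ab {ph} => [|t rs] /=; first by have /and5P[_ _ ? _ _] := withinX i.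
  move=> [_ sr] st _ _ ab; rewrite leNgt; apply/negP => tr.
  have [e te pt] : exists2 e, t.1 < e & step p t.1 e t.2.
    case: rs sr => [|u rs] /=; first by move=> st1; case: (st1) => ? _ _; exists W.
    by case=> st1 _; case: (st1) => ? _ _; exists u.1.
  have [_ _ /(_ i)] := pt; rewrite (negbTE pi) => /(_ ltac:(lra) tr).
  by rewrite /lower in st; lra.
- apply/eqP; rewrite eq_le ly /=; have := ph i; rewrite (negbTE pi); apply => //; lra.
Qed.

(** The real step denoted by a symbolic one, under the values rx and ry of the symbols. *)
Definition value (rx ry : nat -> R) (s : nat * nat) : R * R := (rx s.1, ry s.2).

(** All symbols of st are below n. *)
Definition bounded (n : nat) (st : state) : bool :=
  [&& (1 < n)%N,
      all (fun q : box nat =>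
        [&& (q.1.1 < n)%N, (q.1.2 < n)%N, (q.2.1 < n)%N & (q.2.2 < n)%N]) (tiles st),
      all (fun s => (s.1 < n)%N && (s.2 < n)%N) (focus st :: lefts st ++ rights st) &
      all (fun s => (s.1 < n)%N && (s.2 < n)%N) (facts st)].

(** The stage st of the sweep describes the tiling X, with placed tiles pi, under the values
rx and ry of the symbols. The steps on the left decrease towards the focus. *)
Record valid (st : state) (pi : seq I) (rx ry : nat -> R) : Prop := Valid {
  valid_walls : [/\ rx 0%N = 0, rx 1%N = W, ry 0%N = 0 & ry 1%N = H];
  valid_uniq : uniq pi;
  valid_tiles : map X pi = map (map_box rx ry) (tiles st);
  valid_facts : all (fun e => ry e.1 < ry e.2) (facts st);
  valid_lefts : steps_left (mem pi) (map (value rx ry) (lefts st)) (rx (focus st).1);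
  valid_steep : sorted lower (map (value rx ry) (lefts st));
  valid_rights :
    steps_right (mem pi) (value rx ry (focus st)) (map (value rx ry) (rights st));
  valid_bounded : bounded (fresh st) st }.

(** The focus is also lower than the steps on its left; this is the precondition of [scan],
but [settle] has yet to establish it. *)
Definition steep (st : state) (rx ry : nat -> R) : bool :=
  path lower (value rx ry (focus st)) (map (value rx ry) (lefts st)).

(** The tiling realises a full arrangement accepted by [leaf]. *)
Definition solved (leaf : seq (box nat) -> bool) : Prop :=
  exists ts pi rx ry, [/\ leaf ts, uniq pi, size pi = #|I|,
    map X pi = map (map_box rx ry) ts &
    [/\ rx 0%N = 0, rx 1%N = W, ry 0%N = 0 & ry 1%N = H]].

Lemma redirect_value (ry : nat -> R) a b s : ry a = ry b -> ry (redirect a b s) = ry s.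
Proof. by rewrite /redirect; case: eqVneq => // ->. Qed.

Lemma map_box_redirect (rx ry : nat -> R) a b ts : ry a = ry b ->
  map (map_box rx ry) (map (map_box id (redirect a b)) ts) = map (map_box rx ry) ts.
Proof.
move=> e; rewrite -map_comp; apply: eq_map => q.
by rewrite /map_box /= !redirect_value.
Qed.

Lemma redirect_lt a b s n : (b < n)%N -> (s < n)%N -> (redirect a b s < n)%N.
Proof. by rewrite /redirect; case: ifP. Qed.

Lemma valid_redirect st pi rx ry a b : ry a = ry b -> (b < fresh st)%N ->
  valid st pi rx ry -> valid (redirect_state a b st) pi rx ry.
Proof.
move=> e bn [w u t f l s r bd].
have ev x : value rx ry (x.1, redirect a b x.2) = value rx ry x.
  by rewrite /value /= redirect_value.
have evm xs : map (value rx ry) [seq (x.1, redirect a b x.2) | x <- xs] = map (value rx ry) xs.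
  by rewrite -map_comp; apply: eq_map => x; apply: ev.
split=> //=.
- by rewrite map_box_redirect.
- by rewrite all_map; apply: sub_all f => x /=; rewrite !redirect_value.
- by rewrite evm.
- by rewrite evm.
- by rewrite ev evm.
case/and4P: bd => n1 bt bs bf; rewrite /bounded n1 /=.
rewrite !all_map; apply/and3P; split.
- by apply: sub_all bt => q /= /and4P[-> -> ? ?]; rewrite !redirect_lt.
- have := bs; rewrite /= -map_cat all_map => /andP[/andP[-> f2] bs'] /=.
  rewrite redirect_lt //=; apply: sub_all bs' => q /= /andP[-> ?]; exact: redirect_lt.
- by apply: sub_all bf => q /= /andP[? ?]; rewrite !redirect_lt.
Qed.

Lemma steep_redirect st rx ry a b : ry a = ry b ->
  steep (redirect_state a b st) rx ry = steep st rx ry.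
Proof.
move=> e; rewrite /steep /= /value /= redirect_value //; congr path.
by rewrite -map_comp; apply: eq_map => x /=; rewrite redirect_value.
Qed.

Lemma may_ltP st pi rx ry a b : valid st pi rx ry -> ry a < ry b -> may_lt (facts st) a b.
Proof.
move=> v ab; apply/andP; split; first by apply: contraTneq ab => ->; rewrite ltxx.
apply/negP => F; have /allP/(_ _ F) := valid_facts v.
by rewrite /= ltNge (ltW ab).
Qed.

Lemma may_eqP st pi rx ry a b : valid st pi rx ry -> ry a = ry b -> may_eq (facts st) a b.
Proof.
move=> v ab; apply/orP; right.
by apply/andP; split; apply/negP => F; have /allP/(_ _ F) := valid_facts v;
  rewrite /= ab ltxx.
Qed.

Lemma valid_fact st pi rx ry a b : valid st pi rx ry -> ry a < ry b ->
  (a < fresh st)%N -> (b < fresh st)%N ->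
  valid (State (tiles st) (lefts st) (focus st) (rights st) ((a, b) :: facts st)
           (fresh st)) pi rx ry.
Proof.
move=> [w u t f l s r bd] ab an bn; split=> //=; first by rewrite ab.
by move: bd; rewrite /bounded /= an bn.
Qed.

(** Each stage of the sweep preserves validity along the branch that the tiling follows, so
the test holds at the leaf it reaches. *)
Section Branch.
Variables (leaf : seq (box nat) -> bool) (rec : state -> bool).
Hypothesis cardI : #|I| = 8%N.
Hypothesis rec_sound : forall st pi rx ry,
  valid st pi rx ry -> steep st rx ry -> rec st -> solved leaf.

Lemma settle_sound st pi rx ry :
  valid st pi rx ry -> settle rec st -> solved leaf.
Proof.
move=> v; rewrite /settle.
case El : (lefts st) => [|l ls]; first by apply: rec_sound v _; rewrite /steep El.
have /and4P[n1 bt] := valid_bounded v.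
rewrite El /= => /and3P[/andP[f1 f2] /andP[l1 l2] bs] bf.
case: (ltgtP (ry (focus st).2) (ry l.2)) => hl /and3P[br1 br2 br3].
- move: br1; rewrite (may_ltP v) //; have := valid_fact v hl f2 l2.
  rewrite El => v'; apply: rec_sound v' _.
  by rewrite /steep /= {1}/lower /= hl /=; have := valid_steep v; rewrite El.
- move: br2; rewrite (may_ltP v) //; apply: (@rec_sound _ pi rx ry).
    case: v El => w u t f L S r b El; rewrite El /= in L S; split=> //=.
    + by rewrite hl.
    + by case: L.
    + exact: path_sorted S.
    + by split=> //; case: L => L _; exact: L.
    + rewrite /bounded n1 bt /= l1 l2 f2 bf andbT /=.
      by move: bs; rewrite !all_cat /= f1 f2 => /andP[-> ->].
  by have := valid_steep v; rewrite El.
move: br3; rewrite (may_eqP v) //; apply: (@rec_sound _ pi rx ry).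
  apply: valid_redirect => //.
  case: v El => w u t f L S r b El; rewrite El /= in L S; split=> //=.
  - by case: L.
  - exact: path_sorted S.
  - move: r; case: (rights st) => [|x xs] /=.
      by case: L => L _ r; apply: step_cat L _; rewrite -hl.
    by case=> r ?; split=> //; case: L => L _; apply: step_cat L _; rewrite -hl.
  - by rewrite /bounded /= l1 l2 n1 bt bf /= bs.
rewrite steep_redirect //.
by have := valid_steep v; rewrite El.
Qed.

Lemma place_sound st pi rx ry :
  valid st pi rx ry -> steep st rx ry ->
  (if rights st is x :: _ then ry (focus st).2 < ry x.2 else true) ->
  place leaf rec st -> solved leaf.
Proof.
move=> v sv lr; have := sv; rewrite /place /steep.
case Ef : (focus st) => [a h]; rewrite /= => pl.
have sz : size (tiles st) = size pi.
  by have := congr1 size (valid_tiles v); rewrite !size_map.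
have L := valid_lefts v; have Rt := valid_rights v; rewrite Ef /= in L Rt lr.
have hH : ry h <= H.
  by case: (rights st) Rt => [|x xs] /=; [case=> _ /andP[] | case=> [[_ /andP[]]]].
(* At the top of the square the neighbouring steps cannot be higher, so the staircase
   is flat and all tiles are placed. *)
move: hH; rewrite le_eqVlt => /orP[/eqP hH|hH].
  have El : lefts st = [::].
    case: (lefts st) pl L => // l ls /= /andP[]; rewrite /lower /= => hl _ [[_ /andP[_ lH] _] _].
    by have := lt_le_trans hl lH; rewrite hH ltxx.
  have Er : rights st = [::].
    case: (rights st) lr Rt => // x xs hx [_].
    by case: xs => [|y ys] /=; [case=> _ /andP[_ xH] _ | case=> -[_ /andP[_ xH] _] _];
      have := lt_le_trans hx xH; rewrite hH ltxx.
  rewrite El Er /= in L Rt *.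
  clear Ef; have all_in i : i \in pi.
    apply/negPn/negP => ni; case: Rt => _ _ /(_ i).
    have /and5P[l0 lr' rW b0 /andP[bt tH]] := withinX i.
    rewrite (lt_le_trans lr' rW) L (le_lt_trans l0 lr') /= (negbTE ni) hH.
    by move=> /(_ isT isT) /le_lt_trans /(_ bt) /lt_le_trans /(_ tH); rewrite ltxx.
  have sz8 : size pi = #|I|.
    rewrite -(card_uniqP (valid_uniq v)); apply: eq_card => i.
    by rewrite all_in.
  rewrite sz sz8 cardI /= => lf.
  exists (map (map_box id (redirect h 1)) (tiles st)), pi, rx, ry.
  case: v => -[w1 w2 w3 w4] u t _ _ _ _ _.
  by split=> //; rewrite map_box_redirect // hH w4.
have [i [ni li ri bi]] : exists i, [/\ i \notin pi, (X i).1.1 = rx a,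
    (X i).1.2 <= end_of (map (value rx ry) (rights st)) & (X i).2.1 = ry h].
  apply: (@valley_tile (mem pi) (map (value rx ry) (lefts st)) (rx a, ry h)) => //.
  by case: (rights st) lr.
have -> : (size (tiles st) < 8)%N.
  rewrite sz -cardI.
  have ui : uniq (i :: pi) by rewrite /= ni (valid_uniq v).
  by have := max_card (mem (i :: pi)); rewrite (card_uniqP ui).
set n := fresh st.
(* The fresh symbol stands for the right side of the new tile among abscissas, and for
   its top among ordinates. *)
pose rx' k := if k == n then (X i).1.2 else rx k.
pose ry' k := if k == n then (X i).2.2 else ry k.
have ex k : (k < n)%N -> rx' k = rx k by rewrite /rx' => /ltn_eqF ->.
have ey k : (k < n)%N -> ry' k = ry k by rewrite /ry' => /ltn_eqF ->.
have exn : rx' n = (X i).1.2 by rewrite /rx' eqxx.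
have eyn : ry' n = (X i).2.2 by rewrite /ry' eqxx.
have /and4P[n1 bt] := valid_bounded v.
rewrite Ef /= all_cat -/n => /and3P[/andP[an hn] bl br] bf.
have evs (s : seq (nat * nat)) : all (fun s => (s.1 < n)%N && (s.2 < n)%N) s ->
    map (value rx' ry') s = map (value rx ry) s.
  by move=> /allP bs; apply/eq_in_map => x /bs /andP[? ?]; rewrite /value ex ?ey.
have evt : map (map_box rx' ry') (tiles st) = map (map_box rx ry) (tiles st).
  apply/eq_in_map => q /(allP bt) /and4P[? ? ? ?].
  by rewrite /map_box !ex ?ey.
have evf : all (fun e => ry' e.1 < ry' e.2) (facts st).
  apply/allP => e ef; have /andP[e1 e2] := allP bf _ ef.
  by rewrite !ey //; apply: (allP (valid_facts v)).
have walls : [/\ rx' 0%N = 0, rx' 1%N = W, ry' 0%N = 0 & ry' 1%N = H].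
  by case: (valid_walls v) => *; rewrite !ex ?ey // ltnW.
have uip : uniq (i :: pi) by rewrite /= ni (valid_uniq v).
have hi : ry h < (X i).2.2 by have /and5P[_ _ _ _ /andP[]] := withinX i; rewrite bi.
have lows : steps_left (mem (i :: pi)) (map (value rx' ry') (lefts st)) (rx' a).
  by rewrite evs // ex //; apply: steps_left_add L; rewrite li.
have weak m xs : all (fun s => (s.1 < n)%N && (s.2 < n)%N) xs -> (n <= m)%N ->
    all (fun s : nat * nat => (s.1 < m)%N && (s.2 < m)%N) xs.
  by move=> bs nm; apply: sub_all bs => s /andP[s1 s2]; rewrite !(leq_trans _ nm).
have bt' : all (fun q : box nat => [&& (q.1.1 < n.+1)%N, (q.1.2 < n.+1)%N,
    (q.2.1 < n.+1)%N & (q.2.2 < n.+1)%N]) (tiles st).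
  by apply: sub_all bt => q /and4P[? ? ? ?]; apply/and4P; split; apply: leqW.
have [an' hn'] : (a < n.+1)%N /\ (h < n.+1)%N by split; apply: leqW.
have [bl' br'] := conj (weak _ _ bl (leqnSn n)) (weak _ _ br (leqnSn n)).
have bf' := weak _ _ bf (leqnSn n).
case/andP=> br1 br2.
have [re|re] := eqVneq (X i).1.2 (end_of (map (value rx ry) (rights st))).
  apply: (@settle_sound _ (i :: pi) rx' ry') br1; split=> //=.
  - rewrite evt (valid_tiles v) [X i]surjective_pairing [(X i).1]surjective_pairing.
    rewrite [(X i).2]surjective_pairing li bi /map_box /= (ex a) // (ey h) // eyn.
    congr (((_, _), _) :: _); rewrite re.
    case: (rights st) br => [|x xs] /=.
      by case: (valid_walls v) => _ w1 _ _; rewrite ex.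
    by case/andP=> /andP[x1 _] _; rewrite ex.
  - by rewrite ey // eyn hi.
  - by rewrite evs //; exact: valid_steep v.
  - rewrite /value /= (ex a) // eyn evs //.
    move: Rt re ri; case: (rights st) => [|x xs] /=.
      by move=> st0 re ri; have := step_raise st0 ni li ri bi; rewrite re.
    case=> st0 Rt re ri; split; first by have := step_raise st0 ni li ri bi; rewrite re.
    by apply: steps_right_add.
  - rewrite /bounded /= bt' all_cat an' hn' bl' br' bf' ltnSn leqW //= !andbT.
    by case: (rights st) br' => [|x xs] /=; [rewrite leqW | case/andP => /andP[]].
apply: (@settle_sound _ (i :: pi) rx' ry') br2; split=> //=.
- rewrite evt (valid_tiles v) [X i]surjective_pairing [(X i).1]surjective_pairing.
  by rewrite [(X i).2]surjective_pairing li bi /map_box /= (ex a) // (ey h) // eyn exn.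
- by rewrite ey // eyn hi.
- by rewrite evs //; exact: valid_steep v.
- rewrite /value /= (ex a) // (ey h) // eyn exn evs //.
  have lti : (X i).1.2 < end_of (map (value rx ry) (rights st)) by rewrite lt_neqAle re ri.
  have ai : rx a <= (X i).1.2 by rewrite -li; have /and5P[_ /ltW] := withinX i.
  move: Rt ri lti; case: (rights st) => [|x xs] /=.
    move=> st0 ri lti.
    by split; [have := step_raise st0 ni li ri bi | have := step_rest st0 ai lti].
  by case=> st0 Rt ri lti; split; [have := step_raise st0 ni li ri bi
    | split; [have := step_rest st0 ai lti | apply: steps_right_add]].
- by rewrite /bounded /= bt' all_cat /= an' hn' bl' br' bf' ltnSn leqW.
Qed.

Lemma scan_sound st pi rx ry : (forall i j, ~~ share_side (X i) (X j)) ->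
  valid st pi rx ry -> steep st rx ry -> scan leaf rec st -> solved leaf.
Proof.
move=> ns v sv; rewrite /scan.
have -> : mergeable (tiles st) = false.
  apply/negP => /hasP[q qt /hasP[r rt]].
  have tile_of u : u \in tiles st -> exists i, map_box rx ry u = X i.
    move=> /(map_f (map_box rx ry)); rewrite -(valid_tiles v) => /mapP[i _ ->].
    by exists i.
  have [[i ei] [j ej]] := (tile_of q qt, tile_of r rt).
  have := ns i j; rewrite -ei -ej /share_side /= => /negP nij sh; apply: nij.
  by case/orP: sh => /and3P[/eqP -> /eqP -> /eqP ->]; rewrite !eqxx ?orbT.
case Er : (rights st) => [|x xs]; first by apply: place_sound v sv _; rewrite Er.
case Ef : (focus st) => [a h].
have /and4P[n1 bt] := valid_bounded v.
rewrite Ef Er /= all_cat /= => /and3P[/andP[an hn] bl /andP[/andP[x1 x2] bs]] bf.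
case: (ltgtP (ry x.2) (ry h)) => hx /and3P[br1 br2 br3].
- move: br1; rewrite (may_ltP v) //; apply: (@rec_sound _ pi rx ry).
    case: v Er Ef => w u t f L S r b Er Ef.
    rewrite Er /= Ef in r; rewrite Ef /= in L; case: r => r1 r2.
    split=> //=.
    + by rewrite hx.
    + by move: sv; rewrite /steep Ef.
    + by rewrite /bounded /= n1 bt x1 x2 an hn bf /= all_cat bl bs.
  by rewrite /steep /= {1}/lower /= hx /=; move: sv; rewrite /steep Ef.
- move: br3; rewrite (may_ltP v) //.
  have := valid_fact v hx hn x2; rewrite Er Ef => v'.
  by apply: (place_sound v') => //; move: sv; rewrite /steep Ef.
move: br2; rewrite (may_eqP v) //; apply: (@rec_sound _ pi rx ry).
  apply: valid_redirect => //.
  case: v Er Ef => w u t f L S r b Er Ef.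
  rewrite Er /= Ef in r; rewrite Ef /= in L; case: r => r1 r2.
  split=> //=.
  - move: r2; case: (xs) => [|y ys] /=.
      by move=> r2; apply: step_cat r1 _; rewrite -hx.
    by case=> r2 ?; split=> //; apply: step_cat r1 _; rewrite -hx.
  - by rewrite /bounded /= n1 bt an hn bf /= all_cat bl bs.
by rewrite steep_redirect //; move: sv; rewrite /steep Ef.
Qed.
End Branch.

Lemma search_sound leaf fuel st pi rx ry :
  #|I| = 8%N -> (forall i j, ~~ share_side (X i) (X j)) ->
  valid st pi rx ry -> steep st rx ry -> search leaf fuel st -> solved leaf.
Proof.
move=> cI ns; elim: fuel st pi rx ry => // fuel IH st pi rx ry v sv /=.
exact: (scan_sound cI IH ns v sv).
Qed.

(** If [leaf] holds at all leaves, then a tiling by eight boxes without shared sides realises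
an arrangement accepted by [leaf]. *)
Lemma start_sound leaf fuel : 0 < W -> 0 < H ->
  #|I| = 8%N -> (forall i j, ~~ share_side (X i) (X j)) ->
  search leaf fuel start -> solved leaf.
Proof.
move=> W0 H0 cI ns.
apply: (@search_sound _ _ _ [::] (fun s => if s is 0%N then 0 else W)
  (fun s => if s is 0%N then 0 else H)) => //.
split=> //=; split=> //=; first by rewrite lexx ltW.
by move=> i _ _; have /and5P[_ _ _ ->] := withinX i.
Qed.
End Sound.

(** * Rigidity *)

Section Rigid.
Variable R : realFieldType.

Definition box_width (q : box R) : R := q.1.2 - q.1.1.
Definition box_height (q : box R) : R := q.2.2 - q.2.1.

Lemma same_area_le0 (w h w' h' : R) : 0 < h -> 0 < w' -> w * h = w' * h' ->
  (w - w') * (h - h') <= 0.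
Proof.
move=> h0 w0 e; rewrite -(pmulr_rle0 _ w0).
have -> : w' * ((w - w') * (h - h')) = - (h * (w - w') ^+ 2).
  by rewrite mulrCA mulrBr -e; ring.
by rewrite oppr_le0 mulr_ge0 ?sqr_ge0 // ltW.
Qed.

Lemma same_area_eq (w h w' h' : R) : 0 < h -> 0 < w' -> w * h = w' * h' ->
  (w - w') * (h - h') = 0 -> w = w' /\ h = h'.
Proof.
move=> h0 w0 e /eqP; rewrite mulf_eq0 !subr_eq0 => /orP[]/eqP e1; subst; split=> //.
  by apply: (mulfI (lt0r_neq0 w0)).
by apply: (mulIf (lt0r_neq0 h0)).
Qed.

(** rx and ry place the walls of the type m at those of the square of side W, and give its
boxes positive sides and an eighth of the area. *)
Definition realised (W : R) (m : seq (box nat)) (rx ry : nat -> R) : Prop :=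
  [/\ rx 0%N = 0, rx 5%N = W, ry 0%N = 0, ry 4%N = W &
    forall q, q \in m ->
      [/\ 0 < box_width (map_box rx ry q), 0 < box_height (map_box rx ry q) &
       box_width (map_box rx ry q) * box_height (map_box rx ry q) = W ^+ 2 / 8%:R]].

(** The corner contributions cancel: the signed areas of the tiles add up to that of the
frame, as a formal identity in the coordinates dx and dy. *)
Lemma corner_sum (m : seq (box nat)) (dx dy : nat -> R) : m \in types ->
  \sum_(q <- m) box_width (map_box dx dy q) * box_height (map_box dx dy q) =
  (dx 5%N - dx 0%N) * (dy 4%N - dy 0%N).
Proof.
rewrite /box_width /box_height !inE => /or4P[]/eqP -> ; rewrite unlock /=; ring.
Qed.

(** Two realisations of the same type have tiles of the same sizes. *)
Lemma rigid (W : R) m rx ry rx' ry' : m \in types ->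
  realised W m rx ry -> realised W m rx' ry' ->
  forall q, q \in m -> box_width (map_box rx ry q) = box_width (map_box rx' ry' q) /\
     box_height (map_box rx ry q) = box_height (map_box rx' ry' q).
Proof.
move=> mm [x0 x5 y0 y4 pos] [x0' x5' y0' y4' pos'].
have := corner_sum (fun s => rx' s - rx s) (fun s => ry s - ry' s) mm.
rewrite x0 x5 y0 y4 x0' x5' y0' y4' !subrr mul0r big_seq => /eqP.
rewrite psumr_eq0 => [/allP sum0 q qm|q qm]; have [w0 h0 e] := pos q qm;
  have [w0' h0' e'] := pos' q qm.
  have := sum0 q qm; rewrite qm /= => /eqP s0.
  apply: (same_area_eq h0 w0' (etrans e (esym e'))).
  by move: s0; rewrite /box_width /box_height /= => s0; lra.
have := same_area_le0 h0 w0' (etrans e (esym e')).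
by rewrite /box_width /box_height /=; lra.
Qed.

Definition congruent_boxes (q r : box R) : Prop :=
  (box_width q = box_width r /\ box_height q = box_height r) \/
  (box_width q = box_height r /\ box_height q = box_width r).

(** The half-turn permutes the tiles of this type, so rigidity applies to a realisation and
to its image. *)
Lemma half_turn_type_congruent (W : R) rx ry : realised W half_turn_type rx ry ->
  congruent_boxes (map_box rx ry (quad 0 2 0 2)) (map_box rx ry (quad 4 5 1 4)).
Proof.
move=> re; left; have [x0 x5 y0 y4 pos] := re.
pose ax s := nth 0%N [:: 5; 3; 4; 1; 2; 0]%N s.
pose ay s := nth 0%N [:: 4; 2; 1; 3; 0]%N s.
have re' : realised W half_turn_type (fun s => W - rx (ax s)) (fun s => W - ry (ay s)).
  split; rewrite /ax /ay /= ?x0 ?x5 ?y0 ?y4 ?subrr ?subr0 //.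
  suff key q r : q \in half_turn_type -> r \in half_turn_type ->
      r = ((ax q.1.2, ax q.1.1), (ay q.2.2, ay q.2.1)) ->
     [/\ 0 < box_width (map_box (fun s => W - rx (ax s)) (fun s => W - ry (ay s)) q),
      0 < box_height (map_box (fun s => W - rx (ax s)) (fun s => W - ry (ay s)) q) &
      box_width (map_box (fun s => W - rx (ax s)) (fun s => W - ry (ay s)) q) *
      box_height (map_box (fun s => W - rx (ax s)) (fun s => W - ry (ay s)) q) = W ^+ 2 / 8%:R].
    move=> q qm; apply: (key _ _ qm _ erefl).
    by move: q qm; apply/allP; vm_compute.
  move=> qm rm er; have := pos r rm; rewrite er /box_width /box_height /=.
  by case=> w0 h0 e; split; [lra | lra | rewrite -e; ring].
have [|e1 e2] := rigid _ re re' (mem_head (quad 0 2 0 2) _); first by rewrite !inE eqxx orbT.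
by move: e1 e2; rewrite /box_width /box_height /ax /ay /= => e1 e2; split; lra.
Qed.

(** Likewise with a reflection of the abscissas. *)
Lemma mirror_type_congruent (W : R) rx ry : realised W mirror_type rx ry ->
  congruent_boxes (map_box rx ry (quad 0 2 0 2)) (map_box rx ry (quad 3 5 0 1)).
Proof.
move=> re; left; have [x0 x5 y0 y4 pos] := re.
pose ax s := nth 0%N [:: 5; 4; 3; 2; 1; 0]%N s.
pose ay s := nth 0%N [:: 0; 2; 1; 3; 4]%N s.
have re' : realised W mirror_type (fun s => W - rx (ax s)) (fun s => ry (ay s)).
  split; rewrite /ax /ay /= ?x0 ?x5 ?y0 ?y4 ?subrr ?subr0 //.
  suff key q r : q \in mirror_type -> r \in mirror_type ->
      r = ((ax q.1.2, ax q.1.1), (ay q.2.1, ay q.2.2)) ->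
     [/\ 0 < box_width (map_box (fun s => W - rx (ax s)) (fun s => ry (ay s)) q),
      0 < box_height (map_box (fun s => W - rx (ax s)) (fun s => ry (ay s)) q) &
      box_width (map_box (fun s => W - rx (ax s)) (fun s => ry (ay s)) q) *
      box_height (map_box (fun s => W - rx (ax s)) (fun s => ry (ay s)) q) = W ^+ 2 / 8%:R].
    move=> q qm; apply: (key _ _ qm _ erefl).
    by move: q qm; apply/allP; vm_compute.
  move=> qm rm er; have := pos r rm; rewrite er /box_width /box_height /=.
  by case=> w0 h0 e; split; [lra | lra | rewrite -e; ring].
have [|e1 e2] := rigid _ re re' (mem_head (quad 0 2 0 2) _); first by rewrite !inE eqxx !orbT.
by move: e1 e2; rewrite /box_width /box_height /ax /ay /= => e1 e2; split; lra.
Qed.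
End Rigid.

Lemma perm_map_lift (T U : eqType) (h : T -> U) (s : seq U) (t : seq T) :
  perm_eq s (map h t) -> exists2 t', perm_eq t' t & s = map h t'.
Proof.
case: t => [|x t].
  by move=> /perm_nilP ->; exists [::].
move=> /(perm_iotaP (h x)) [js pj ->]; exists (map (nth x (x :: t)) js).
  apply/(perm_iotaP x); exists js => //; by rewrite size_map in pj.
rewrite -map_comp; apply/eq_in_map => j; rewrite (perm_mem pj) mem_iota size_map => /andP[_ ?].
by rewrite (nth_map x).
Qed.

Lemma fitsP m ts : fits m ts -> exists fx fy : nat -> nat,
  [/\ fx 0 = 0, fx 5 = 1, fy 0 = 0, fy 4 = 1 & perm_eq (map (map_box fx fy) m) ts]%N.
Proof.
rewrite /fits; case: assign => // -[fx fy] /and5P[/eqP ? /eqP ? /eqP ? /eqP ? ?].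
by exists (rename fx), (rename fy).
Qed.

Section Moves.
Variables (R : realFieldType) (W : R).

Lemma mirrorK : involutive mirror. Proof. by case=> [|[|]]. Qed.

(** Symmetries act on the values of the symbols. *)
Lemma move_realised (g : bool * bool * bool) (rx ry : nat -> R) :
  [/\ rx 0%N = 0, rx 1%N = W, ry 0%N = 0 & ry 1%N = W] ->
  exists rx' ry' : nat -> R,
    [/\ rx' 0%N = 0, rx' 1%N = W, ry' 0%N = 0 & ry' 1%N = W] /\
    forall q, move_box (fun v => W - v) g (map_box rx ry q) =
      map_box rx' ry' (move_box mirror g q).
Proof.
move=> [x0 x1 y0 y1].
pose f (b : bool) (r : nat -> R) s := if b then W - r (mirror s) else r s.
have fb b r : r 0%N = 0 -> r 1%N = W -> f b r 0%N = 0 /\ f b r 1%N = W.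
  by move=> r0 r1; rewrite /f; case: b; rewrite /= ?r0 ?r1 ?subrr ?subr0.
case: g => [[a b] c].
have [fx0 fx1] := fb a rx x0 x1; have [fy0 fy1] := fb b ry y0 y1.
exists (if c then f b ry else f a rx), (if c then f a rx else f b ry).
split; first by case: c.
move=> [[l r] [d u]]; rewrite /f.
by case: a b c {fx0 fx1 fy0 fy1} => [] [] []; rewrite /move_box /map_box /flip_interval /= ?mirrorK.
Qed.
End Moves.

Section Improper.
Variables (R : realFieldType) (I : finType) (W : R) (X : I -> box R).

(** Between two and #|I| - 1 of the tiles fill a box. *)
Definition merging : Prop := exists (A : {set I}) (q : box R),
  [/\ (1 < #|A| < #|I|)%N, within W W q &
      forall x y, half_open q x y = [exists i in A, half_open (X i) x y]].

Lemma belowP n F a b (r : nat -> R) : {in F, forall e, r e.1 < r e.2} ->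
  below n F a b -> r a <= r b.
Proof.
move=> rF; elim: n a => [|n IH] a /=; first by case: eqVneq => // ->.
case: eqVneq => [->|_]; first by [].
case/hasP=> e eF; case: eqVneq => // <- /IH; apply: le_trans.
exact: ltW (rF _ eF).
Qed.

Lemma improperP ts pi rx ry : box_tiling W W X -> uniq pi -> size pi = #|I| ->
  map X pi = map (map_box rx ry) ts -> #|I| = 8%N -> improper ts -> merging.
Proof.
move=> tX upi spi e I8.
have ipi i : i \in pi.
  by rewrite (subset_cardP (etrans (card_uniqP upi) spi) (subset_predT _)).
have tile_of r : r \in ts -> exists i, X i = map_box rx ry r.
  move=> /(map_f (map_box rx ry)); rewrite -e => /mapP[i _ ->]; by exists i.
have sym_of i : exists2 r, r \in ts & X i = map_box rx ry r.
  by have := map_f X (ipi i); rewrite e => /mapP[r rt ->]; exists r.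
case: (tX) => wX cX aX.
have xlt : {in map fst ts, forall s, rx s.1 < rx s.2}.
  move=> _ /mapP[r /tile_of[i ei] ->]; have := wX i.
  by rewrite ei => /and5P[].
have ylt : {in map snd ts, forall s, ry s.1 < ry s.2}.
  move=> _ /mapP[r /tile_of[i ei] ->]; have := wX i.
  by rewrite ei => /and5P[_ _ _ _ /andP[]].
have lex a b : below 8 (map fst ts) a b -> rx a <= rx b := @belowP _ _ a b rx xlt.
have ley a b : below 8 (map snd ts) a b -> ry a <= ry b := @belowP _ _ a b ry ylt.
case/hasP=> q1 q1t /hasP[q2 q2t].
set q := ((q1.1.1, q2.1.2), (q1.2.1, q2.2.2)).
pose ins (r : box R) := let q := map_box rx ry q in
  [&& q.1.1 <= r.1.1, r.1.2 <= q.1.2, q.2.1 <= r.2.1 & r.2.2 <= q.2.2].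
pose outs (r : box R) := let q := map_box rx ry q in
  [|| r.1.2 <= q.1.1, q.1.2 <= r.1.1, r.2.2 <= q.2.1 | q.2.2 <= r.2.1].
case/andP => /allP al cnt.
have [al' cnt'] : (forall i, ins (X i) || outs (X i)) /\ (1 < #|[set i | ins (X i)]| < 8)%N.
  have insP r : r \in ts ->
      [&& below 8 [seq i.1 | i <- ts] q.1.1 r.1.1, below 8 [seq i.1 | i <- ts] r.1.2 q.1.2,
        below 8 [seq i.2 | i <- ts] q.2.1 r.2.1 &
        below 8 [seq i.2 | i <- ts] r.2.2 q.2.2] -> ins (map_box rx ry r).
    by move=> _ /and4P[/lex ? /lex ? /ley ? /ley ?]; apply/and4P; split.
  have outP r : r \in ts ->
      [|| below 8 [seq i.1 | i <- ts] r.1.2 q.1.1, below 8 [seq i.1 | i <- ts] q.1.2 r.1.1,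
        below 8 [seq i.2 | i <- ts] r.2.2 q.2.1 |
        below 8 [seq i.2 | i <- ts] q.2.2 r.2.1] -> outs (map_box rx ry r).
    move=> _ /or4P[/lex ?|/lex ?|/ley ?|/ley ?]; apply/or4P;
      by [apply: Or41 | apply: Or42 | apply: Or43 | apply: Or44].
  split.
    move=> i; have [r rt ->] := sym_of i.
    by have /orP[/(insP _ rt) ->|/(outP _ rt) ->] := al _ rt; rewrite ?orbT.
  move: cnt; set c := count _ ts; suff -> : #|[set i | ins (X i)]| = c by [].
  have -> : #|[set i | ins (X i)]| = #|[seq i <- pi | ins (X i)]|.
    by apply: eq_card => i; rewrite inE mem_filter ipi andbT.
  rewrite (card_uniqP (filter_uniq _ upi)) size_filter.
  have -> : count (fun i => ins (X i)) pi = count ins (map X pi) by rewrite count_map.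
  rewrite e count_map; apply: eq_in_count => r rt /=.
  have [i ei] := tile_of r rt; have := wX i; rewrite ei => /and5P[_ lr _ _ /andP[bt _]].
  have /orP[r_in|r_out] := al _ rt; first by rewrite r_in (insP _ rt).
  have ni : ~~ ins (map_box rx ry r).
    apply/negP => /and4P[i1 i2 i3 i4].
    by have /or4P[] := outP _ rt r_out => o; clear -lr bt i1 i2 i3 i4 o; lra.
  by rewrite (negbTE ni); apply/esym/negbTE; apply: contra ni => /(insP _ rt).
have [i iin] : exists i, ins (X i).
  have /card_gt0P[i] : (0 < #|[set i | ins (X i)]|)%N.
    by apply: leq_trans (_ : 2 <= _)%N; case/andP: cnt'.
  by rewrite inE; exists i.
have wq : within W W (map_box rx ry q).
  have [i1 e1] := tile_of _ q1t; have [i2 e2] := tile_of _ q2t.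
  have := wX i1; have := wX i2; have := wX i; rewrite e1 e2; move: iin; clear.
  rewrite /ins /within /= => /and4P[? ? ? ?] /and5P[? ? ? ? /andP[? ?]].
  move=> /and5P[? ? ? ? /andP[? ?]] /and5P[? ? ? ? /andP[? ?]].
  apply/and5P; split; [lra..| apply/andP; split; lra].
exists [set i | ins (X i)], (map_box rx ry q); rewrite I8; split=> // x y; clear e spi I8.
apply/idP/exists_inP => [/and4P[x1 x2 y1 y2]|[j]]; last first.
  rewrite inE => /and4P[? ? ? ?] /and4P[? ? ? ?].
  by apply/and4P; split; lra.
have /and5P[? ? ? ? /andP[? ?]] := wq.
have [||j hj] := cX x y; [lra|lra|].
exists j => //; rewrite inE.
have /orP[//|] := al' j.
by have /and4P[? ? ? ?] := hj => /or4P[] o; exfalso; lra.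
Qed.
End Improper.

(** Two boxes that share a side fill a box. *)
Section Sides.
Variables (R : realFieldType) (W : R) (q r : box R).
Hypotheses (wq : within W W q) (wr : within W W r).

Lemma within_pile : q.2.2 = r.2.1 -> within W W (q.1, (q.2.1, r.2.2)).
Proof.
case/and5P: wq => l0 lr rW b0 /andP[bt _]; case/and5P: wr => _ _ _ _ /andP[bt' tW'] e.
apply/and5P; split=> //=; rewrite tW' andbT.
by apply: lt_trans bt _; rewrite e.
Qed.

Lemma within_row : q.1.2 = r.1.1 -> within W W ((q.1.1, r.1.2), q.2).
Proof.
case/and5P: wq => l0 lr rW b0 btW; case/and5P: wr => _ lr' rW' _ _ e.
apply/and5P; split=> //=.
by apply: lt_trans lr _; rewrite e.
Qed.

Lemma half_open_pile (x y : R) : q.1.1 = r.1.1 -> q.1.2 = r.1.2 -> q.2.2 = r.2.1 ->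
  half_open (q.1, (q.2.1, r.2.2)) x y = half_open q x y || half_open r x y.
Proof.
move=> e1 e2 e3; rewrite /half_open /= e1 e2 e3.
case/and5P: wq => _ _ _ _ /andP[bt _]; case/and5P: wr => _ _ _ _ /andP[bt' _].
rewrite e3 in bt.
case: (r.1.1 <= x) => //=; case: (x < r.1.2) => //=.
case: (ltP y r.2.1) => yr; first by rewrite (lt_trans yr bt') /= orbF.
by rewrite andbF (le_trans (ltW bt) yr).
Qed.

Lemma half_open_row x y : q.2.1 = r.2.1 -> q.2.2 = r.2.2 -> q.1.2 = r.1.1 ->
  half_open ((q.1.1, r.1.2), q.2) x y = half_open q x y || half_open r x y.
Proof.
move=> e1 e2 e3; rewrite /half_open /= e1 e2 e3.
case/and5P: wq => _ lt1 _ _ _; case/and5P: wr => _ lt2 _ _ _.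
rewrite e3 in lt1.
case: (_ && (y < _)) => //=; rewrite ?andbF // !andbT.
case: (ltP x r.1.1) => xr; first by rewrite (lt_trans xr lt2) /= orbF.
by rewrite andbF (le_trans (ltW lt1) xr).
Qed.
End Sides.

Section Classify.
Variables (R : realFieldType) (I : finType) (W : R) (X : I -> box R).
Hypotheses (W0 : 0 < W) (I8 : #|I| = 8%N) (tX : box_tiling W W X).
Hypothesis nX : ~ merging W X.

Lemma no_pile i j :
  ~~ [&& (X i).1.1 == (X j).1.1, (X i).1.2 == (X j).1.2 & (X i).2.2 == (X j).2.1].
Proof.
apply/negP => /and3P[/eqP e1 /eqP e2 /eqP e3]; apply: nX.
have wi := withinX tX i; have wj := withinX tX j.
have ij : i != j.
  apply/eqP => ij; have /and5P[_ _ _ _ /andP[]] := wi.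
  by rewrite e3 ij ltxx.
exists [set i; j], ((X i).1, ((X i).2.1, (X j).2.2)).
rewrite cards2 ij I8; split=> // [|x y]; first exact: within_pile wi wj e3.
rewrite (half_open_pile wi wj x y e1 e2 e3).
apply/orP/exists_inP => [[]|[k]]; last by rewrite !inE => /orP[]/eqP ->; [left|right].
  by exists i; rewrite ?set21.
by exists j; rewrite ?set22.
Qed.

Lemma no_row i j :
  ~~ [&& (X i).2.1 == (X j).2.1, (X i).2.2 == (X j).2.2 & (X i).1.2 == (X j).1.1].
Proof.
apply/negP => /and3P[/eqP e1 /eqP e2 /eqP e3]; apply: nX.
have wi := withinX tX i; have wj := withinX tX j.
have ij : i != j.
  apply/eqP => ij; have /and5P[_ + _ _ _] := wi.
  by rewrite e3 ij ltxx.
exists [set i; j], (((X i).1.1, (X j).1.2), (X i).2).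
rewrite cards2 ij I8; split=> // [|x y]; first exact: within_row wi wj e3.
rewrite (half_open_row wi wj x y e1 e2 e3).
apply/orP/exists_inP => [[]|[k]]; last by rewrite !inE => /orP[]/eqP ->; [left|right].
  by exists i; rewrite ?set21.
by exists j; rewrite ?set22.
Qed.

Lemma no_shared_side i j : ~~ share_side (X i) (X j).
Proof. by rewrite /share_side negb_or no_pile no_row. Qed.

Definition moved (g : bool * bool * bool) (q : box R) : box R :=
  move_box (fun v => W - v) g q.

Lemma moved_size g q :
  box_width (moved g q) = (if g.2 then box_height q else box_width q) /\
  box_height (moved g q) = (if g.2 then box_width q else box_height q).
Proof.
case: q => [[l r] [b t]]; case: g => [[[] []] []];
  rewrite /moved /box_width /box_height /move_box /flip_interval /=; split; ring.
Qed.

Lemma congruent_moved g q r : congruent_boxes (moved g q) (moved g r) -> congruent_boxes q r.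
Proof.
rewrite /congruent_boxes; have [-> ->] := moved_size g q; have [-> ->] := moved_size g r.
by case: ifP => _ [[-> ->]|[-> ->]]; auto.
Qed.

Hypothesis areaX : forall i, box_width (X i) * box_height (X i) = W ^+ 2 / 8%:R.
Hypothesis distinctX : forall i j, i != j -> ~ congruent_boxes (X i) (X j).

(** A tiling of the square by eight boxes of equal areas, pairwise not congruent and not
merging, is of the first or of the second type up to a symmetry. *)
Lemma box_classification : exists g m pi rx ry,
  [/\ m \in [:: first_type; second_type], uniq pi, size pi = #|I|, realised W m rx ry &
      map (moved g \o X) pi = map (map_box rx ry) m].
Proof.
have [ts [pi [rx [ry [kn upi spi e walls]]]]] :=
  @start_sound R I W W X tX recognised 17 W0 W0 I8 no_shared_side search_recognised.
have imp : improper ts = false by apply/negP => /(improperP tX upi spi e I8).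
move: kn; rewrite /recognised imp => /hasP[g _ /hasP[m mm fm]].
have [rx' [ry' [walls' mv]]] := move_realised g walls.
have [fx [fy [fx0 fx5 fy0 fy4 pm]]] := fitsP fm.
have e2 : map (moved g \o X) pi = map (map_box rx' ry') (map (move_box mirror g) ts).
  by rewrite map_comp e -!map_comp; apply: eq_map => q; apply: mv.
have [|pi' ppi e3] := @perm_map_lift _ _ (moved g \o X)
    (map (map_box rx' ry') (map (map_box fx fy) m)) pi.
  by rewrite e2; apply: perm_map.
have upi' : uniq pi' by rewrite (perm_uniq ppi).
have re : realised W m (rx' \o fx) (ry' \o fy).
  case: walls' => *; split; rewrite /= ?fx0 ?fx5 ?fy0 ?fy4 //.
  move=> q qm; have := map_f (map_box rx' ry') (map_f (map_box fx fy) qm).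
  rewrite e3 => /mapP[i _ ei].
  have -> : map_box (rx' \o fx) (ry' \o fy) q = moved g (X i).
    by rewrite -[RHS]/((moved g \o X) i) -ei.
  have [-> ->] := moved_size g (X i); have /and5P[? ? ? ? /andP[? ?]] := withinX tX i.
  have ar := areaX i; have [? ?] : 0 < box_width (X i) /\ 0 < box_height (X i).
    by rewrite /box_width /box_height !subr_gt0.
  by case: ifP => _; split; rewrite // mulrC.
exists g, m, pi', (rx' \o fx), (ry' \o fy); split=> //; last first.
- by rewrite -e3 -map_comp; apply: eq_map.
- by rewrite (perm_size ppi).
have uniq_tile q r : q \in m -> r \in m ->
   congruent_boxes (map_box (rx' \o fx) (ry' \o fy) q) (map_box (rx' \o fx) (ry' \o fy) r) ->
   map_box (rx' \o fx) (ry' \o fy) q = map_box (rx' \o fx) (ry' \o fy) r.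
  move=> qm rm.
  have := map_f (map_box rx' ry') (map_f (map_box fx fy) qm).
  have := map_f (map_box rx' ry') (map_f (map_box fx fy) rm).
  rewrite e3 => /mapP[j _ ej] /mapP[i _ ei] /=.
  have -> : map_box (rx' \o fx) (ry' \o fy) q = moved g (X i).
    by rewrite -[RHS]/((moved g \o X) i) -ei.
  have -> : map_box (rx' \o fx) (ry' \o fy) r = moved g (X j).
    by rewrite -[RHS]/((moved g \o X) j) -ej.
  by move=> /congruent_moved; case: (eqVneq i j) => [->//|/distinctX].
move: mm re uniq_tile; rewrite !inE => /or4P[]/eqP -> re ut; rewrite ?eqxx ?orbT //; exfalso.
  have := ut _ _ _ _ (half_turn_type_congruent re); rewrite !inE !eqxx ?orbT => /(_ isT isT).
  move=> /(congr1 (fun q => q.1.1)); rewrite /map_box => /= e04.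
  have [_ _ _ _ pos] := re.
  have [] := pos (quad 0 2 0 2) isT; have [] := pos (quad 2 3 0 3) isT.
  have [] := pos (quad 3 4 1 3) isT; rewrite /box_width /map_box /= -e04 !subr_gt0.
  move=> w34 _ _ w23 _ _ w02 _ _.
  by have := lt_trans w02 (lt_trans w23 w34); rewrite ltxx.
have := ut _ _ _ _ (mirror_type_congruent re); rewrite !inE !eqxx ?orbT => /(_ isT isT).
move=> /(congr1 (fun q => q.1.1)); rewrite /map_box => /= e04.
have [_ _ _ _ pos] := re.
have [] := pos (quad 0 2 0 2) isT; have [] := pos (quad 2 3 0 3) isT.
rewrite /box_width /map_box /= -e04 !subr_gt0 => w23 _ _ w02 _ _.
by have := lt_trans w02 w23; rewrite ltxx.
Qed.
End Classify.

(** * The two solutions *)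

Section Existence.
Variable R : rcfType.

Definition quartic (p : R) : R :=
  512 * p ^+ 4 - 1224 * p ^+ 3 + 1023 * p ^+ 2 - 342 * p + 36.

(** A sign change of s times the quartic yields a root. *)
Lemma quartic_root (s a b : R) : a <= b -> s * quartic a <= 0 -> 0 <= s * quartic b ->
  exists2 p, a <= p <= b & s * quartic p = 0.
Proof.
move=> ab fa fb.
pose P : {poly R} := s *: (512 *: 'X^4 - 1224 *: 'X^3 + 1023 *: 'X^2 - 342 *: 'X + 36%:P).
have PE x : P.[x] = s * quartic x by rewrite /P /quartic !hornerE.
have [|p pab /rootP] := @poly_ivt R P a b ab; first by rewrite !PE fa fb.
by rewrite PE => e; exists p.
Qed.

Lemma quartic_root_first :
  exists2 p, 85208%:R / 100000%:R <= p <= 85209%:R / 100000%:R & quartic p = 0.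
Proof.
have [||| p pab e] := @quartic_root 1 (85208%:R / 100000%:R) (85209%:R / 100000%:R).
- lra.
- by rewrite /quartic; lra.
- by rewrite /quartic; lra.
by exists p => //; rewrite mul1r in e.
Qed.

Lemma quartic_root_second :
  exists2 p, 8317%:R / 10000%:R <= p <= 8318%:R / 10000%:R & quartic p = 0.
Proof.
have [||| p pab e] := @quartic_root (-1) (8317%:R / 10000%:R) (8318%:R / 10000%:R).
- lra.
- by rewrite /quartic; lra.
- by rewrite /quartic; lra.
by exists p => //; lra.
Qed.

(** The coordinates other than p of the tilings of the first and of the second type, in the
unit square. The areas of all tiles but two determine them in terms of p; the quartic is
what remains of one of the last two equations, and the other one then holds because the
areas sum to 1. In the order of the first type the abscissas are 0, [xa], [xb], [xc],
[xd], 1 and the ordinates 0, [ya], [yb], p, 1; in the second type [xb] comes after [xd]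
and [yb] before [ya]. *)
Section Coordinates.
Variable p : R.
Definition xa := 1 / (8 * p).
Definition xd := 1 / (8 * (1 - p)).
Definition xb := (41 - 48 * p) / (8 * (6 - 7 * p)).
Definition xc := (16 * p - 13) / (16 * (4 * p - 3) * (1 - p)).
Definition ya := (6 - 7 * p) / (7 - 8 * p).
Definition yb := - (p * (6 - 7 * p) / (6 * (8 * p ^+ 2 - 8 * p + 1))).

Lemma bound_quotient (n d lo hi : R) : 0 < d -> lo * d < n -> n < hi * d -> lo < n / d < hi.
Proof. by move=> d0 l h; rewrite ltr_pdivlMr // ltr_pdivrMr // l h. Qed.

Hypothesis fp : quartic p = 0.

(** The areas of the tiles in the order of [first_type]. *)
Lemma areas : 4 * p - 3 != 0 -> p != 0 -> 1 - p != 0 -> 6 - 7 * p != 0 -> 7 - 8 * p != 0 ->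
  8 * p ^+ 2 - 8 * p + 1 != 0 ->
  [/\ xa * p = 1 / 8, (xb - xa) * yb = 1 / 8, (1 - xb) * ya = 1 / 8,
      (xc - xb) * (yb - ya) = 1 / 8 &
  [/\ (xd - xc) * (p - ya) = 1 / 8, (xc - xa) * (p - yb) = 1 / 8,
      (1 - xd) * (1 - ya) = 1 / 8 & xd * (1 - p) = 1 / 8]].
Proof.
move=> h1 h2 h3 h4 h5 h6.
have t0 : xa * p = 1 / 8 by rewrite /xa; field.
have t1 : (xb - xa) * yb = 1 / 8 by rewrite /xa /xb /yb; field; rewrite ?h2 ?h4 ?h6.
have t2 : (1 - xb) * ya = 1 / 8 by rewrite /xb /ya; field; rewrite ?h4 ?h5.
have t4 : (xd - xc) * (p - ya) = 1 / 8 by rewrite /xc /xd /ya; field; rewrite ?h1 ?h3 ?h5.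
have t5 : (xc - xa) * (p - yb) = 1 / 8.
  apply/eqP; rewrite -subr_eq0; apply/eqP.
  have -> : (xc - xa) * (p - yb) - 1 / 8 =
      quartic p / (32 * (4 * p - 3) * (1 - p) * (8 * p ^+ 2 - 8 * p + 1)).
    by rewrite /xa /xc /yb /quartic; field; rewrite ?h1 ?h2 ?h3 ?h6.
  by rewrite fp mul0r.
have t6 : (1 - xd) * (1 - ya) = 1 / 8 by rewrite /xd /ya; field; rewrite ?h3 ?h5.
have t7 : xd * (1 - p) = 1 / 8 by rewrite /xd; field.
split=> //.
have -> : (xc - xb) * (yb - ya) = 1 - (xa * p + (xb - xa) * yb + (1 - xb) * ya +
  (xd - xc) * (p - ya) + (xc - xa) * (p - yb) + (1 - xd) * (1 - ya) + xd * (1 - p)) by ring.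
by rewrite t0 t1 t2 t4 t5 t6 t7; field.
Qed.
End Coordinates.

(** The root has to be located to five decimals, because the denominator of [yb] is close to
-0.008 there. *)
Lemma bounds_first p : 85208%:R / 100000%:R <= p <= 85209%:R / 100000%:R ->
  [/\ 146 / 1000 < xa p < 147 / 1000, 352 / 1000 < xb p < 354 / 1000,
      655 / 1000 < xc p < 656 / 1000, 845 / 1000 < xd p < 846 / 1000 &
  [/\ 192 / 1000 < ya p < 194 / 1000, 605 / 1000 < yb p < 609 / 1000 &
      852 / 1000 < p < 853 / 1000]].
Proof.
move=> /andP[lp up]; split; last split.
- by apply: bound_quotient; lra.
- by apply: bound_quotient; lra.
- by apply: bound_quotient; nra.
- by apply: bound_quotient; lra.
- by apply: bound_quotient; lra.
- by rewrite /yb -mulrN -invrN; apply: bound_quotient; nra.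
- by apply/andP; split; lra.
Qed.

Lemma bounds_second p : 8317%:R / 10000%:R <= p <= 8318%:R / 10000%:R ->
  [/\ 150 / 1000 < xa p < 151 / 1000, 3782 / 5000 < xb p < 757 / 1000,
      349 / 1000 < xc p < 351 / 1000, 742 / 1000 < xd p < 3716 / 5000 &
  [/\ 513 / 1000 < ya p < 515 / 1000, 206 / 1000 < yb p < 207 / 1000 &
     831 / 1000 < p < 832 / 1000]].
Proof.
move=> /andP[lp up]; split; last split.
- by apply: bound_quotient; lra.
- by apply: bound_quotient; lra.
- by apply: bound_quotient; nra.
- by apply: bound_quotient; lra.
- by apply: bound_quotient; lra.
- by rewrite /yb -mulrN -invrN; apply: bound_quotient; nra.
- by apply/andP; split; lra.
Qed.
End Existence.

(** Tilings obtained from a tiling of the grid by stretching its lines. *)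
Section Grid.
Variables (R : realFieldType) (W : R) (m : seq (box nat)) (xs ys : nat -> R).

(** The values r 0, ..., r n increase from 0 to W. *)
Definition increasing (r : nat -> R) (n : nat) : Prop :=
  r 0%N = 0 /\ r n = W /\ forall i, (i < n)%N -> r i < r i.+1.

Lemma increasing_lt r n i j : increasing r n -> (i < j <= n)%N -> r i < r j.
Proof.
move=> [_ [_ inc]]; elim: j => // j IH /andP[]; rewrite ltnS leq_eqVlt => /orP[/eqP ->|ij] jn.
  exact: inc.
by apply: lt_trans (inc _ jn); apply: IH; rewrite ij ltnW.
Qed.

Lemma increasing_le r n i j : increasing r n -> (i <= j <= n)%N -> r i <= r j.
Proof.
move=> inc /andP[]; rewrite leq_eqVlt => /orP[/eqP ->|ij jn]; first by rewrite lexx.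
by apply/ltW/(increasing_lt inc); rewrite ij.
Qed.

Lemma increasing_ltn r n i j : increasing r n -> (i <= n)%N -> (j <= n)%N ->
  r i < r j -> (i < j)%N.
Proof.
move=> inc i_n jn; apply: contraLR; rewrite -leqNgt -leNgt => ji.
by apply: (increasing_le inc); rewrite ji.
Qed.

Lemma increasing_cell r n x : increasing r n -> 0 <= x < W ->
  exists2 i, (i < n)%N & r i <= x < r i.+1.
Proof.
move=> [r0 [<- _]]; elim: n => [|n IH] /andP[x0 xn]; first by move: xn; rewrite r0 ltNge x0.
case: (ltP x (r n)) => xr; last by exists n; rewrite ?xr.
by have [|i i_n h] := IH; [rewrite x0 | exists i => //; apply: ltnW].
Qed.

Hypotheses (incx : increasing xs 5) (incy : increasing ys 4).
Hypothesis gm : grid_tiled m.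

Definition model_box (k : 'I_8) : box R := map_box xs ys (tile m k).

Let sz : size m = 8%N. Proof. by case/and4P: gm => /eqP. Qed.

Lemma tile_in (k : 'I_8) : tile m k \in m.
Proof. by apply: mem_nth; rewrite sz. Qed.

Lemma tile_ranks q : q \in m -> (q.1.1 < q.1.2 <= 5)%N && (q.2.1 < q.2.2 <= 4)%N.
Proof. by case/and4P: gm => _ /allP h _ _ /h. Qed.

Lemma model_tiling : box_tiling W W model_box.
Proof.
have [x0 [x5 _]] := incx; have [y0 [y4 _]] := incy.
split=> [k|x y xW yW|k l kl].
- have /andP[/andP[l1 l2] /andP[l3 l4]] := tile_ranks (tile_in k).
  apply/and5P; split; last (apply/andP; split).
  + by rewrite -x0; apply: (increasing_le incx); rewrite /= ltnW // (leq_trans l1).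
  + by apply: (increasing_lt incx); rewrite l1.
  + by rewrite -x5; apply: (increasing_le incx); rewrite l2 leqnn.
  + by rewrite -y0; apply: (increasing_le incy); rewrite /= ltnW // (leq_trans l3).
  + by apply: (increasing_lt incy); rewrite l3.
  + by rewrite -y4; apply: (increasing_le incy); rewrite l4 leqnn.
- have [i i5 /andP[xi xi']] := increasing_cell incx xW.
  have [j j4 /andP[yj yj']] := increasing_cell incy yW.
  case/and4P: gm => _ _ /allP/(_ i) + _; rewrite mem_iota => /(_ i5) /allP/(_ j).
  rewrite mem_iota => /(_ j4) /(has_nthP (quad 0 0 0 0))[k].
  rewrite sz => k8 /and4P[q1 q2 q3 q4]; exists (Ordinal k8).
  have /andP[/andP[l1 l2] /andP[l3 l4]] := tile_ranks (tile_in (Ordinal k8)).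
  apply/and4P; split=> /=.
  + by apply: le_trans xi; apply: (increasing_le incx); rewrite q1 ltnW.
  + by apply: (lt_le_trans xi'); apply: (increasing_le incx); rewrite q2.
  + by apply: le_trans yj; apply: (increasing_le incy); rewrite q3 ltnW.
  + by apply: (lt_le_trans yj'); apply: (increasing_le incy); rewrite q4.
have /andP[/andP[l1 l2] /andP[l3 l4]] := tile_ranks (tile_in k).
have /andP[/andP[m1 m2] /andP[m3 m4]] := tile_ranks (tile_in l).
apply/negP => /and4P[o1 o2 o3 o4].
case/and4P: gm => _ _ _ /allP/(_ k); rewrite mem_iota => /(_ (ltn_ord k)) /allP/(_ l).
rewrite mem_iota => /(_ (ltn_ord l)); rewrite (inj_eq val_inj) (negbTE kl) /= => /negP; apply.
apply/and4P; split.
- by apply: (increasing_ltn incx) o1; rewrite ?m2 // ltnW // (leq_trans l1).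
- by apply: (increasing_ltn incx) o2; rewrite ?l2 // ltnW // (leq_trans m1).
- by apply: (increasing_ltn incy) o3; rewrite ?m4 // ltnW // (leq_trans l3).
- by apply: (increasing_ltn incy) o4; rewrite ?l4 // ltnW // (leq_trans m3).
Qed.

Definition closed_box (q : box R) (x y : R) : bool :=
  [&& q.1.1 <= x, x <= q.1.2, q.2.1 <= y & y <= q.2.2].

Lemma common_point (a b c d : R) : a < b -> c < d -> a < d -> c < b ->
  exists x, [/\ a < x, x < b, c < x & x < d].
Proof.
move=> ab cd ad cb; exists ((Num.max a c + Num.min b d) / 2).
by case: (ltP a c) => ?; case: (ltP b d) => ?; split; lra.
Qed.

Lemma model_unmergeable (A : {set 'I_8}) (q : box R) : unmergeable m ->
  (1 < #|A| < 8)%N ->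
  ~ (forall x y, closed_box q x y <-> exists2 i, i \in A & closed_box (model_box i) x y).
Proof.
move=> um cA qA.
have wX := withinX model_tiling.
pose s := [seq i \in A | i <- enum 'I_8].
have ss : size s = 8%N by rewrite size_map size_enum_ord.
have em : m = [seq tile m (val i) | i <- enum 'I_8].
  rewrite map_comp val_enum_ord; apply: (@eq_from_nth _ (quad 0 0 0 0)).
    by rewrite size_map size_iota sz.
  by move=> i; rewrite sz => i8; rewrite (nth_map 0%N) ?size_iota // nth_iota.
have ms (b : pred 'I_8) u : u \in mask [seq b i | i <- enum 'I_8] m ->
    exists2 i, b i & u = tile m (val i).
  rewrite {1}em -map_mask -filter_mask => /mapP[i]; rewrite mem_filter => /andP[bi _] ->.
  by exists i.
have cs : count id s = #|A|.
  rewrite count_map -size_filter -(card_uniqP (filter_uniq _ (enum_uniq _))).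
  by apply: eq_card => i; rewrite mem_filter mem_enum andbT.
have := allP um s; rewrite -{1}ss mem_masks cs cA => /(_ isT) /hasP[q0].
rewrite /s -map_comp => /(ms (fun i => i \notin A))[k kA ->] /and4P[].
move=> /hasP[_ /ms[i1 i1A ->] o1] /hasP[_ /ms[i2 i2A ->] o2].
move=> /hasP[_ /ms[i3 i3A ->] o3] /hasP[_ /ms[i4 i4A ->] o4].
have sub (i : 'I_8) : i \in A -> [/\ q.1.1 <= (model_box i).1.1, (model_box i).1.2 <= q.1.2,
    q.2.1 <= (model_box i).2.1 & (model_box i).2.2 <= q.2.2].
  move=> iA; have /and5P[_ lr _ _ /andP[bt _]] := wX i.
  have /and4P[c1 _ c3 _] : closed_box q (model_box i).1.1 (model_box i).2.1.
    by apply/qA; exists i => //; apply/and4P; rewrite !lexx !ltW.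
  have /and4P[_ c2 _ c4] : closed_box q (model_box i).1.2 (model_box i).2.2.
    by apply/qA; exists i => //; apply/and4P; rewrite !lexx !ltW.
  by [].
have wk (i j : 'I_8) : ((tile m i).1.1 < (tile m j).1.2)%N ->
    (model_box i).1.1 < (model_box j).1.2.
  have /andP[/andP[_ l2] _] := tile_ranks (tile_in j).
  by move=> ij; apply: (increasing_lt incx); rewrite ij.
have hk (i j : 'I_8) : ((tile m i).2.1 < (tile m j).2.2)%N ->
    (model_box i).2.1 < (model_box j).2.2.
  have /andP[_ /andP[_ l2]] := tile_ranks (tile_in j).
  by move=> ij; apply: (increasing_lt incy); rewrite ij.
have [s11 s12 s13 s14] := sub _ i1A; have [s21 s22 s23 s24] := sub _ i2A.
have [s31 s32 s33 s34] := sub _ i3A; have [s41 s42 s43 s44] := sub _ i4A.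
have /and5P[_ lr1 _ _ /andP[bt1 _]] := wX i1.
have /and5P[_ lrk _ _ /andP[btk _]] := wX k.
have [x [x1 x2 x3 x4]] : exists x,
    [/\ (model_box k).1.1 < x, x < (model_box k).1.2, q.1.1 < x & x < q.1.2].
  apply: common_point => //.
  - exact: le_lt_trans s11 (lt_le_trans lr1 s12).
  - exact: lt_le_trans (wk _ _ o1) s12.
  - exact: le_lt_trans s21 (wk _ _ o2).
have [y [y1 y2 y3 y4]] : exists y,
    [/\ (model_box k).2.1 < y, y < (model_box k).2.2, q.2.1 < y & y < q.2.2].
  apply: common_point => //.
  - exact: le_lt_trans s13 (lt_le_trans bt1 s14).
  - exact: lt_le_trans (hk _ _ o3) s34.
  - exact: le_lt_trans s43 (hk _ _ o4).
have : closed_box q x y by apply/and4P; split; apply: ltW.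
move=> /qA[j jA /and4P[j1 j2 j3 j4]].
have kj : k != j by apply: contraNneq kA => ->.
have [_ _ /(_ _ _ kj) /negP] := model_tiling; apply; apply/and4P; split.
- exact: lt_le_trans x1 j2.
- exact: le_lt_trans j1 x2.
- exact: lt_le_trans y1 j4.
- exact: le_lt_trans j3 y2.
Qed.
End Grid.

Section Solutions.
Variables (R : rcfType) (W : R).
Hypothesis W0 : 0 < W.

Definition scaled (s : seq R) (k : nat) : R := W * nth 0 s k.

(** xs and ys are increasing coordinates of a tiling of type m of the square of side W, with
equal areas and without congruent tiles. *)
Definition solution (m : seq (box nat)) (xs ys : nat -> R) : Prop :=
  [/\ increasing W xs 5, increasing W ys 4, realised W m xs ys &
    forall i j : 'I_8, i != j ->
      ~ congruent_boxes (model_box m xs ys i) (model_box m xs ys j)].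

Lemma increasing_scaled (s : seq R) n : nth 0 s 0 = 0 -> nth 0 s n = 1 ->
  all (fun i => nth 0 s i < nth 0 s i.+1) (iota 0 n) -> increasing W (scaled s) n.
Proof.
move=> s0 s1 /allP inc; rewrite /increasing /scaled s0 s1 mulr0 mulr1; split=> //; split=> // i ni.
by rewrite ltr_pM2l // inc // mem_iota.
Qed.

Definition unit_box (m : seq (box nat)) (s t : seq R) (k : nat) : box R :=
  map_box (nth 0 s) (nth 0 t) (tile m k).

Lemma scaled_size s t q :
  box_width (map_box (scaled s) (scaled t) q) = W * box_width (map_box (nth 0 s) (nth 0 t) q) /\
  box_height (map_box (scaled s) (scaled t) q) = W * box_height (map_box (nth 0 s) (nth 0 t) q).
Proof. by rewrite /box_width /box_height /scaled /= !mulrBr. Qed.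

Definition half_perimeter (q : box R) : R := box_width q + box_height q.

(** A solution in the unit square, scaled by W. The list r enumerates the tiles by increasing
half-perimeter, which shows that no two are congruent. *)
Lemma solution_scaled m s t (r : seq nat) : grid_tiled m ->
  [/\ nth 0 s 0 = 0, nth 0 s 5 = 1, nth 0 t 0 = 0 & nth 0 t 4 = 1] ->
  all (fun i => nth 0 s i < nth 0 s i.+1) (iota 0 5) ->
  all (fun i => nth 0 t i < nth 0 t i.+1) (iota 0 4) ->
  (forall k, (k < 8)%N ->
     box_width (unit_box m s t k) * box_height (unit_box m s t k) = 1 / 8) ->
  perm_eq r (iota 0 8) ->
  sorted <%R [seq half_perimeter (unit_box m s t k) | k <- r] ->
  solution m (scaled s) (scaled t).
Proof.
move=> gm [s0 s5 t0 t4] incs inct ar pr sr.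
have m8 : size m = 8%N by case/and4P: gm => /eqP.
have is5 := increasing_scaled s0 s5 incs; have it4 := increasing_scaled t0 t4 inct.
split=> //.
  have [x0 [x5 _]] := is5; have [y0 [y4 _]] := it4; split=> // q qm.
  have /andP[/andP[l1 l2] /andP[l3 l4]] := tile_ranks gm qm.
  rewrite /box_width /box_height !subr_gt0; split.
  - by apply: (increasing_lt is5); rewrite l1.
  - by apply: (increasing_lt it4); rewrite l3.
  have /(nthP (quad 0 0 0 0))[k] := qm; rewrite m8 => k8 <-.
  have [+ +] := scaled_size s t (nth (quad 0 0 0 0) m k).
  rewrite /box_width /box_height => -> ->.
  by rewrite mulrACA [X in _ * X](ar k k8) mul1r -expr2.
move=> i j ij cij; case/negP: ij; rewrite -(inj_eq val_inj) /=.
have hp : half_perimeter (unit_box m s t i) = half_perimeter (unit_box m s t j).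
  apply: (mulfI (lt0r_neq0 W0)); rewrite /half_perimeter [LHS]mulrDr [RHS]mulrDr.
  have [wi hi] := scaled_size s t (tile m i); have [wj hj] := scaled_size s t (tile m j).
  rewrite /unit_box -wi -hi -wj -hj.
  by case: cij => -[-> ->]; rewrite // addrC.
have := lt_sorted_uniq sr.
have ir (k : 'I_8) : (val k) \in r by rewrite (perm_mem pr) mem_iota ltn_ord.
move=> ur; apply/eqP; have := ir i; have := ir j.
elim: r ur {sr pr ir} => //= k r IH /andP[kr ur].
rewrite !inE => /orP[/eqP ejk | jr] /orP[/eqP eik | ri]; last exact: IH.
- by rewrite eik ejk.
- by case/negP: kr; rewrite -ejk -hp; apply: map_f.
by case/negP: kr; rewrite -eik hp; apply: map_f.
Qed.

(** The square of the length of the diagonal. *)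
Definition diagonal2 (q : box R) : R := box_width q ^+ 2 + box_height q ^+ 2.

Lemma scaled_diagonal2 s t q :
  diagonal2 (map_box (scaled s) (scaled t) q) = W ^+ 2 * diagonal2 (map_box (nth 0 s) (nth 0 t) q).
Proof. by rewrite /diagonal2; have [-> ->] := scaled_size s t q; rewrite !exprMn mulrDr. Qed.

Lemma denominators (p : R) : 831 / 1000 < p -> p < 853 / 1000 ->
  [/\ 4 * p - 3 != 0, p != 0, 1 - p != 0, 6 - 7 * p != 0 &
     7 - 8 * p != 0 /\ 8 * p ^+ 2 - 8 * p + 1 != 0].
Proof.
move=> p1 p2; split; last split; first [by rewrite gt_eqF //; lra | by rewrite lt_eqF //; nra].
Qed.

(** The bound on the diagonal separates this solution from the second one. *)
Lemma solution_first : exists xs ys, solution first_type xs ys /\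
  74 / 100 * W ^+ 2 < diagonal2 (model_box first_type xs ys ord0).
Proof.
have [p pb fp] := quartic_root_first R.
have bounds := bounds_first pb; clear pb.
have [d1 d2 d3 d4 [d5 d6]] : [/\ 4 * p - 3 != 0, p != 0, 1 - p != 0, 6 - 7 * p != 0 &
     7 - 8 * p != 0 /\ 8 * p ^+ 2 - 8 * p + 1 != 0].
  by case: bounds => _ _ _ _ [_ _ /andP[p1 p2]]; apply: denominators => //; clear -p1; lra.
have [t0 t1 t2 t3 [t4 t5 t6 t7]] := areas fp d1 d2 d3 d4 d5 d6.
move: (xa p) (xb p) (xc p) (xd p) (ya p) (yb p) bounds t0 t1 t2 t3 t4 t5 t6 t7.
clear fp d1 d2 d3 d4 d5 d6 => a b c d u v.
move=> [/andP[a1 a2] /andP[b1 b2] /andP[c1 c2] /andP[d1 d2]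
  [/andP[u1 u2] /andP[v1 v2] /andP[p1 p2]]].
move=> t0 t1 t2 t3 t4 t5 t6 t7.
exists (scaled [:: 0; a; b; c; d; 1]), (scaled [:: 0; u; v; p; 1]); split.
  apply: (@solution_scaled _ _ _ [:: 3; 5; 1; 2; 4; 6; 7; 0]%N) => //.
  - clear t0 t1 t2 t3 t4 t5 t6 t7; rewrite /= !andbT; do 4?[apply/andP; split].
    + by clear -a1; lra.
    + by clear -a2 b1; lra.
    + by clear -b2 c1; lra.
    + by clear -c2 d1; lra.
    + by clear -d2; lra.
  - clear t0 t1 t2 t3 t4 t5 t6 t7; rewrite /= !andbT; do 3?[apply/andP; split].
    + by clear -u1; lra.
    + by clear -u2 v1; lra.
    + by clear -v2 p1; lra.
    + by clear -p2; lra.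
  - by case=> [|[|[|[|[|[|[|[|//]]]]]]]] _; rewrite /box_width /box_height /= ?subr0.
  clear t0 t1 t2 t3 t4 t5 t6 t7; rewrite /half_perimeter /box_width /box_height /= !andbT.
  do 6?[apply/andP; split].
  - by clear -b1 a2 v2 u1 p1; lra.
  - by clear -c2 p2 v1 b1; lra.
  - by clear -b2 a1 v2 u1; lra.
  - by clear -b1 u2 d1 c2 p1; lra.
  - by clear -d2 c1 p2; lra.
  - by clear -d1 u1 p2; lra.
  - by clear -d2 a1 p1; lra.
rewrite /model_box scaled_diagonal2 mulrC ltr_pM2l ?exprn_gt0 //.
rewrite /diagonal2 /box_width /box_height /= !subr0.
clear -a1 p1; nra.
Qed.

(** With the area fixed, short sides bound the diagonal. *)
Lemma diagonal2_le (q : box R) : 0 < box_width q -> 0 < box_height q ->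
  box_width q * box_height q = 1 / 8 -> box_width q <= 84 / 100 -> box_height q <= 84 / 100 ->
  diagonal2 q <= 73 / 100.
Proof.
rewrite /diagonal2; move: (box_width q) (box_height q) => w h w0 h0 e lw lh.
have : 0 <= (84 / 100 - w) * (84 / 100 - h) by rewrite mulr_ge0 // subr_ge0.
have -> : (84 / 100 - w) * (84 / 100 - h) = (84 / 100) ^+ 2 - 84 / 100 * (w + h) + w * h by ring.
have -> : w ^+ 2 + h ^+ 2 = (w + h) ^+ 2 - 2 * (w * h) by ring.
rewrite e; have : 0 < w + h by rewrite addr_gt0.
move: (w + h) => s s0 ls; have s1 : s <= 989 / 1000 by clear -ls; lra.
have : s ^+ 2 <= (989 / 1000) ^+ 2 by rewrite ler_pXn2r ?nnegrE // ltW //; lra.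
by clear; lra.
Qed.

Lemma solution_second : exists xs ys, solution second_type xs ys /\
  forall k, diagonal2 (model_box second_type xs ys k) <= 73 / 100 * W ^+ 2.
Proof.
have [p pb fp] := quartic_root_second R.
have bounds := bounds_second pb; clear pb.
have [d1 d2 d3 d4 [d5 d6]] : [/\ 4 * p - 3 != 0, p != 0, 1 - p != 0, 6 - 7 * p != 0 &
     7 - 8 * p != 0 /\ 8 * p ^+ 2 - 8 * p + 1 != 0].
  by case: bounds => _ _ _ _ [_ _ /andP[p1 p2]]; apply: denominators => //; clear -p2; lra.
have [t0 t1 t2 t3 [t4 t5 t6 t7]] := areas fp d1 d2 d3 d4 d5 d6.
move: (xa p) (xb p) (xc p) (xd p) (ya p) (yb p) bounds t0 t1 t2 t3 t4 t5 t6 t7.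
clear fp d1 d2 d3 d4 d5 d6 => a b c d u v.
move=> [/andP[a1 a2] /andP[b1 b2] /andP[c1 c2] /andP[d1 d2]
  [/andP[u1 u2] /andP[v1 v2] /andP[p1 p2]]].
move=> t0 t1 t2 t3 t4 t5 t6 t7.
have t3' : (b - c) * (u - v) = 1 / 8 by rewrite -t3 -mulrNN !opprB.
have ar k : (k < 8)%N ->
    box_width (unit_box second_type [:: 0; a; c; d; b; 1] [:: 0; v; u; p; 1] k) *
    box_height (unit_box second_type [:: 0; a; c; d; b; 1] [:: 0; v; u; p; 1] k) = 1 / 8.
  by case: k => [|[|[|[|[|[|[|[|//]]]]]]]] _; rewrite /box_width /box_height /= ?subr0.
exists (scaled [:: 0; a; c; d; b; 1]), (scaled [:: 0; v; u; p; 1]).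
have sol : solution second_type (scaled [:: 0; a; c; d; b; 1]) (scaled [:: 0; v; u; p; 1]).
  apply: (@solution_scaled _ _ _ [:: 5; 4; 6; 2; 1; 3; 7; 0]%N) => //;
    clear t0 t1 t2 t3 t3' t4 t5 t6 t7 ar.
  - rewrite /= !andbT; do 4?[apply/andP; split].
    + by clear -a1; lra.
    + by clear -a2 c1; lra.
    + by clear -c2 d1; lra.
    + by clear -d2 b1; lra.
    + by clear -b2; lra.
  - rewrite /= !andbT; do 3?[apply/andP; split].
    + by clear -v1; lra.
    + by clear -v2 u1; lra.
    + by clear -u2 p1; lra.
    + by clear -p2; lra.
  rewrite /half_perimeter /box_width /box_height /= !andbT.
  do 6?[apply/andP; split].
  - by clear -d2 b1 p2 u1 v2; lra.
  - by clear -b2 c1 u2 v1 d2; lra.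
  - by clear -d1 b2 u1; lra.
  - by clear -b1 u2 a2 v1; lra.
  - by clear -b2 v2 c1 p1; lra.
  - by clear -c2 a1 p2 v1 d1; lra.
  - by clear -d2 a1 p1; lra.
split=> // k; rewrite /model_box scaled_diagonal2 mulrC ler_pM2r ?exprn_gt0 //.
have [_ _ [_ _ _ _ pos] _] := sol.
have [+ + _] := pos _ (tile_in (proj1 (andP second_type_grid)) k).
have [-> ->] := scaled_size [:: 0; a; c; d; b; 1] [:: 0; v; u; p; 1] (tile second_type k).
rewrite !pmulr_rgt0 // => w0 h0; apply: diagonal2_le => //; first exact: ar.
  (* one decimal is enough for these bounds *)
  have [? ? ? ?] : [/\ 0 < a, a < 2 / 10, 7 / 10 < b & b < 8 / 10].
    by clear -a1 a2 b1 b2; split; lra.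
  have [? ? ? ?] : [/\ 3 / 10 < c, c < 4 / 10, 7 / 10 < d & d < 8 / 10].
    by clear -c1 c2 d1 d2; split; lra.
  clear a1 a2 b1 b2 c1 c2 d1 d2 u1 u2 v1 v2 p1 p2 t0 t1 t2 t3 t3' t4 t5 t6 t7 ar sol pos w0 h0.
  by case: k => [[|[|[|[|[|[|[|[|//]]]]]]]] ?]; rewrite /box_width /=; lra.
have [? ? ? ?] : [/\ 5 / 10 < u, u < 6 / 10, 2 / 10 < v & v < 3 / 10].
  by clear -u1 u2 v1 v2; split; lra.
have [? ?] : 8 / 10 < p /\ p < 84 / 100 by clear -p1 p2; split; lra.
clear a1 a2 b1 b2 c1 c2 d1 d2 u1 u2 v1 v2 p1 p2 t0 t1 t2 t3 t3' t4 t5 t6 t7 ar sol pos w0 h0.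
by case: k => [[|[|[|[|[|[|[|[|//]]]]]]]] ?]; rewrite /box_height /=; lra.
Qed.
End Solutions.

(** * Tiles are parallel to the tiled rectangle *)

Section Pick.
Variable R : realFieldType.

Lemma smaller_than (s : seq R) : all (fun x => 0 < x) s ->
  exists2 e, 0 < e & all (fun x => e < x) s.
Proof.
elim: s => [_|x s IH /= /andP[x0 /IH[e e0 es]]]; first by exists 1.
exists (Num.min x e / 2); first by rewrite divr_gt0 // lt_min x0.
have m0 : 0 < Num.min x e by rewrite lt_min x0.
have lt_m : Num.min x e / 2 < Num.min x e by rewrite ltr_pdivrMr // ltr_pMr // ltr1n.
apply/andP; split; first by apply: (lt_le_trans lt_m); rewrite ge_min lexx.
apply: sub_all es => y; apply: lt_trans; apply: (lt_le_trans lt_m).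
by rewrite ge_min lexx orbT.
Qed.

Lemma negative_affine (A B : R) : A < 0 ->
  exists2 e, 0 < e & forall t, 0 < t -> t <= e -> A + t * B < 0.
Proof.
move=> A0; exists (- A / (`|B| + 1)).
  by rewrite divr_gt0 ?oppr_gt0 // ltr_wpDl.
move=> t t0; rewrite ler_pdivlMr ?ltr_wpDl // mulrDr mulr1 => le_t.
have : t * B <= t * `|B| by rewrite ler_pM2l // ler_norm.
lra.
Qed.

(** If for all small t some F i t holds, for i in a finite type, and F i fails for small t
whenever G i fails, then some i satisfies both G i and F i t for some t. With F i t stating
that the tile i contains a point that depends on t, this replaces passing to the limit. *)
Lemma eventually_pick (I : finType) (G : I -> Prop) (F : I -> R -> Prop) e0 :
  0 < e0 -> (forall t, 0 < t -> t <= e0 -> exists i, F i t) ->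
  (forall i, ~ G i -> exists2 e, 0 < e & forall t, 0 < t -> t <= e -> ~ F i t) ->
  (forall i, G i \/ ~ G i) ->
  exists i t, [/\ 0 < t, t <= e0, G i & F i t].
Proof.
move=> e00 cov bad dec.
have [e [ep ee ebad]] : exists e,
    [/\ 0 < e, e <= e0 & forall i, i \in enum I -> ~ G i -> ~ F i e].
  suff [e [ep ee ebad]] : exists e, [/\ 0 < e, e <= e0 &
      forall i, i \in enum I -> ~ G i -> forall t, 0 < t -> t <= e -> ~ F i t].
    by exists e; split=> // i ii ng; apply: ebad ii ng e ep (lexx e).
  elim: (enum I) => [|i s [e [ep ee ebad]]]; first by exists e0.
  have [Gi|nGi] := dec i.
    exists e; split=> // j; rewrite inE => /orP[/eqP -> //|]; exact: ebad.
  have [e' e'0 bade'] := bad i nGi.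
  exists (Num.min e e'); rewrite lt_min ge_min ep e'0 ee; split=> // j.
  rewrite inE => /orP[/eqP ->|js] ng t t0; rewrite le_min => /andP[te te'].
    exact: bade'.
  exact: ebad te.
have [i Fi] := cov e ep ee.
exists i, e; split=> //; have [//|ng] := dec i.
by case: (ebad i _ ng Fi); rewrite mem_enum.
Qed.
End Pick.

(** Rectangles in the frame of the rectangle [0, W] x [0, H] that they tile: the i-th has a
side w i along the unit vector (c i, s i) of the first quadrant, a side h i along
(- s i, c i), and its lowest corner at (vx i, vy i). *)
Section Tilt.
Variables (R : realFieldType) (I : finType) (W H : R) (c s vx vy w h : I -> R).
Hypotheses (c_gt0 : forall i, 0 < c i) (s_ge0 : forall i, 0 <= s i).
Hypothesis cs1 : forall i, c i ^+ 2 + s i ^+ 2 = 1.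
Hypotheses (w_gt0 : forall i, 0 < w i) (h_gt0 : forall i, 0 < h i).

(** The coordinates of (x, y) in the frame of the i-th rectangle. *)
Definition along i x y := (x - vx i) * c i + (y - vy i) * s i.
Definition across i x y := (y - vy i) * c i - (x - vx i) * s i.
Definition in_tile i x y :=
  [&& 0 <= along i x y, along i x y <= w i, 0 <= across i x y & across i x y <= h i].
Definition in_open_tile i x y :=
  [&& 0 < along i x y, along i x y < w i, 0 < across i x y & across i x y < h i].

Hypothesis cover : forall x y, 0 <= x <= W -> 0 <= y <= H -> exists i, in_tile i x y.
Hypothesis in_frame : forall i x y, in_tile i x y -> 0 <= x <= W /\ 0 <= y <= H.
Hypothesis disjoint_tiles : forall i j x y, i != j ->
  in_open_tile i x y -> ~~ in_open_tile j x y.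

Lemma c_le1 i : c i <= 1.
Proof. have := cs1 i; have := c_gt0 i; have := sqr_ge0 (s i); nra. Qed.
Lemma s_le1 i : s i <= 1.
Proof. have := cs1 i; have := s_ge0 i; have := sqr_ge0 (c i); nra. Qed.

Lemma along_shift i x y t a b :
  along i (x + t * a) (y + t * b) = along i x y + t * (a * c i + b * s i).
Proof. by rewrite /along; ring. Qed.
Lemma across_shift i x y t a b :
  across i (x + t * a) (y + t * b) = across i x y + t * (b * c i - a * s i).
Proof. by rewrite /across; ring. Qed.

Lemma along_corner i : along i (vx i) (vy i) = 0.
Proof. by rewrite /along !subrr !mul0r addr0. Qed.
Lemma across_corner i : across i (vx i) (vy i) = 0.
Proof. by rewrite /across !subrr !mul0r subr0. Qed.

(** Some tile contains the lowest corner of a tilted tile i and a point just below its first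
side, in the direction (c i, s i / 2). *)
Lemma neighbour_at i : 0 < s i -> exists j t,
  [/\ 0 < t, in_tile j (vx i) (vy i) & in_tile j (vx i + t * c i) (vy i + t * (s i / 2))].
Proof.
move=> s0; set a := c i; set b := s i / 2.
have a0 : 0 < a := c_gt0 i.
have b0 : 0 < b by rewrite divr_gt0.
have [v1 v2] : 0 <= vx i <= W /\ 0 <= vy i <= H.
  by apply: (@in_frame i); rewrite /in_tile along_corner across_corner !lexx !ltW.
have [v3 v4] : 0 <= vx i + w i * c i <= W /\ 0 <= vy i + w i * s i <= H.
  apply: (@in_frame i); rewrite /in_tile along_shift across_shift along_corner across_corner.
  rewrite -!expr2 cs1 mulr1 [c i * s i]mulrC subrr mulr0 !add0r !lexx.
  by rewrite !ltW.
have [|||j [t [t0 _ Gj Fj]]] := @eventually_pick R I (fun j => in_tile j (vx i) (vy i))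
  (fun j t => in_tile j (vx i + t * a) (vy i + t * b)) (w i) (w_gt0 i).
- move=> t t0 tw; apply: cover.
    apply/andP; split; first by case/andP: v1 => v1 _; rewrite addr_ge0 // mulr_ge0 ?ltW.
    have /andP[_] := v3; apply: le_trans; by rewrite lerD2l ler_pM2r.
  apply/andP; split; first by case/andP: v2 => v2 _; rewrite addr_ge0 // mulr_ge0 ?ltW.
  have /andP[_] := v4; apply: le_trans; rewrite lerD2l ler_pM ?(ltW t0) ?(ltW b0) //.
  by rewrite /b; lra.
- move=> j /negP; rewrite /in_tile !negb_and -!ltNge => /or4P[] neg.
  + have [e e0 he] := negative_affine (a * c j + b * s j) neg.
    exists e => // t t0 te; rewrite along_shift => /and4P[+ _ _ _].
    by have := he t t0 te; rewrite ltNge => /negP.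
  + have [|e e0 he] := @negative_affine R (w j - along j (vx i) (vy i))
      (- (a * c j + b * s j)); first by rewrite subr_lt0.
    by exists e => // t t0 te; rewrite along_shift => /and4P[_ + _ _]; have := he t t0 te; lra.
  + have [e e0 he] := negative_affine (b * c j - a * s j) neg.
    exists e => // t t0 te; rewrite across_shift => /and4P[_ _ + _].
    by have := he t t0 te; rewrite ltNge => /negP.
  + have [|e e0 he] := @negative_affine R (h j - across j (vx i) (vy i))
      (- (b * c j - a * s j)); first by rewrite subr_lt0.
    by exists e => // t t0 te; rewrite across_shift => /and4P[_ _ _ +]; have := he t t0 te; lra.
- by move=> j; case: (in_tile j _ _); [left|right].
by exists j, t.
Qed.

(** The point at abscissa e along the first side and k e along the second one. *)
Lemma open_near_corner i k e : 0 < k -> 0 < e -> e < w i -> k * e < h i ->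
  in_open_tile i (vx i + e * (c i - k * s i)) (vy i + e * (s i + k * c i)).
Proof.
move=> k0 e0 ew eh.
rewrite /in_open_tile along_shift across_shift along_corner across_corner !add0r.
have -> : (c i - k * s i) * c i + (s i + k * c i) * s i = c i ^+ 2 + s i ^+ 2 by ring.
have -> : (s i + k * c i) * c i - (c i - k * s i) * s i = k * (c i ^+ 2 + s i ^+ 2) by ring.
by rewrite cs1 !mulr1 e0 ew mulr_gt0 //= mulrC.
Qed.

Lemma no_tilt i : s i = 0.
Proof.
apply/eqP; case: (eqVneq (s i) 0) => // si.
have {si} si : 0 < s i by rewrite lt_neqAle eq_sym si s_ge0.
(* Among the tilted tiles, take one whose lowest corner is lowest. *)
case: (@arg_minP _ _ _ i (fun k => 0 < s k) vy si) => {si}i si low.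
have [j [t [t0 /and4P[a1 a2 b1 b2] /and4P[]]]] := neighbour_at si.
rewrite !along_shift !across_shift => a3 a4 b3 b4.
have ci := c_gt0 i; have cj := c_gt0 j; have ci1 := c_le1 i; have cj1 := c_le1 j.
have si1 := s_le1 i; have sj1 := s_le1 j.
have ij : i != j.
  apply/eqP => ij; subst j; move: b3; rewrite across_corner add0r pmulr_rge0 //.
  have := mulr_gt0 ci si; lra.
(* The tile j is parallel to the frame, or tilted with the same lowest corner as i. *)
have [sj|sj] := eqVneq (s j) 0.
  have cj' : c j = 1.
    have := cs1 j; rewrite sj expr0n addr0 => /eqP; rewrite sqrf_eq1 => /orP[/eqP //|/eqP e].
    by move: cj; rewrite e; lra.
  move: a3 a4 b3 b4; rewrite sj cj' !mulr0 !mulr1 subr0 addr0 => a3 a4 b3 b4.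
  pose k := c i / 2.
  have [] := @smaller_than R [:: w i; h i; t; t * s i / 4].
    by rewrite /= w_gt0 h_gt0 t0 !mulr_gt0 // invr_gt0.
  move=> e e0 /and5P[ew eh et es _].
  have k0 : 0 < k by rewrite divr_gt0.
  have keh : k * e < h i.
    apply: le_lt_trans eh; rewrite ler_piMl ?(ltW e0) // /k; lra.
  have := disjoint_tiles ij (open_near_corner k0 e0 ew keh).
  case/negP; rewrite /in_open_tile along_shift across_shift sj cj' !mulr0 !mulr1 subr0 addr0.
  have cs : 0 < c i - k * s i.
    rewrite subr_gt0 (le_lt_trans (ler_piMr (ltW k0) si1)) // /k; lra.
  have sk : 0 < s i + k * c i by rewrite addr_gt0 // mulr_gt0.
  apply/and4P; split.
  - by rewrite ltr_wpDl // mulr_gt0.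
  - apply: lt_le_trans a4; rewrite ltrD2l.
    apply: (@lt_le_trans _ _ (t * (c i - k * s i))); first by rewrite ltr_pM2r.
    by rewrite ler_pM2l // lerBlDr lerDl mulr_ge0 // ltW.
  - by rewrite ltr_wpDl // mulr_gt0.
  - apply: lt_le_trans b4; rewrite ltrD2l.
    apply: (@le_lt_trans _ _ (e * 2)); last by lra.
    rewrite ler_pM2l //.
    have : k * c i <= 1 by rewrite mulr_ile1 ?(ltW k0) ?(ltW ci) // /k; lra.
    lra.
have {}sj : 0 < s j by rewrite lt_neqAle eq_sym sj s_ge0.
have lij := low j sj.
(* The lowest corner of j is not below that of i, which belongs to j, so they coincide. *)
have ey : vy i - vy j = along j (vx i) (vy i) * s j + across j (vx i) (vy i) * c j.
  rewrite /along /across -[LHS]mulr1 -(cs1 j); ring.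
have ex : vx i - vx j = along j (vx i) (vy i) * c j - across j (vx i) (vy i) * s j.
  rewrite /along /across -[LHS]mulr1 -(cs1 j); ring.
have [al0 be0] : along j (vx i) (vy i) = 0 /\ across j (vx i) (vy i) = 0.
  have p1 := mulr_ge0 a1 (ltW sj); have p2 := mulr_ge0 b1 (ltW cj).
  have e1 : along j (vx i) (vy i) * s j = 0 by lra.
  have e2 : across j (vx i) (vy i) * c j = 0 by lra.
  move/eqP: e1; move/eqP: e2; rewrite !mulf_eq0 (gt_eqF sj) (gt_eqF cj) !orbF.
  by move=> /eqP -> /eqP ->.
move: b3; rewrite al0 be0 in a4 b4 *; rewrite add0r pmulr_rge0 // => b3.
pose k := c i * c j / 2; pose K := s i * c j - c i * s j; pose D := c i * c j + s i * s j.
have k0 : 0 < k by rewrite divr_gt0 // mulr_gt0.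
have k1 : k <= 1.
  have : c i * c j <= 1 by rewrite mulr_ile1 // ltW.
  rewrite /k; lra.
have D0 : 0 < D by rewrite /D addr_gt0 // mulr_gt0.
have K0 : 0 < K.
  have := mulr_gt0 si cj; rewrite /K; lra.
have K1 : K <= 1.
  have : s i * c j <= 1 by rewrite mulr_ile1 // ltW.
  have := mulr_gt0 ci sj; rewrite /K; lra.
have D2 : D <= 2.
  have : c i * c j <= 1 by rewrite mulr_ile1 // ltW.
  have : s i * s j <= 1 by rewrite mulr_ile1 // ltW.
  rewrite /D; lra.
have [] := @smaller_than R [:: w i; h i; w j / 2; h j / 3].
  by rewrite /= w_gt0 h_gt0 !divr_gt0.
move=> e e0 /and5P[ew eh ewj ehj _].
have keh : k * e < h i by apply: le_lt_trans eh; rewrite ler_piMl // ltW.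
have := disjoint_tiles ij (open_near_corner k0 e0 ew keh).
case/negP; rewrite /in_open_tile along_shift across_shift al0 be0 !add0r.
have -> : (c i - k * s i) * c j + (s i + k * c i) * s j = D - k * K by rewrite /D /K; ring.
have -> : (s i + k * c i) * c j - (c i - k * s i) * s j = K + k * D by rewrite /D /K; ring.
have kK : k * K <= k by rewrite ler_piMr // ltW.
have kK0 : 0 < k * K by rewrite mulr_gt0.
have Dk : 0 < D - k * K.
  have := mulr_gt0 si sj; have := mulr_gt0 ci cj; rewrite /k /D in kK kK0 *; lra.
have kD : k * D <= D by rewrite ler_piMl // ltW.
have kD0 : 0 < k * D by rewrite mulr_gt0.
apply/and4P; split.
- by rewrite mulr_gt0.
- apply: (@le_lt_trans _ _ (e * 2)); last by lra.
  by rewrite ler_pM2l //; lra.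
- by rewrite mulr_gt0 // addr_gt0.
- apply: (@le_lt_trans _ _ (e * 3)); last by lra.
  by rewrite ler_pM2l //; lra.
Qed.
End Tilt.

Local Open Scope classical_set_scope.

Section Geometry.
Variable R : realType.
Implicit Types (S A B : rectangle R) (p q : R * R).

(** The coordinates of a point in the frame of S, and the point with given coordinates. *)
Definition abscissa S p : R :=
  (p.1 - (corner S).1) * (direction S).1 + (p.2 - (corner S).2) * (direction S).2.
Definition ordinate S p : R :=
  (p.2 - (corner S).2) * (direction S).1 - (p.1 - (corner S).1) * (direction S).2.
Definition at_coordinates S (x y : R) : R * R :=
  ((corner S).1 + x * (direction S).1 - y * (direction S).2,
   (corner S).2 + x * (direction S).2 + y * (direction S).1).

Lemma abscissaK S x y : abscissa S (at_coordinates S x y) = x.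
Proof.
rewrite /abscissa /at_coordinates /=; rewrite -[RHS]mulr1 -(direction_unit S); ring.
Qed.

Lemma ordinateK S x y : ordinate S (at_coordinates S x y) = y.
Proof.
rewrite /ordinate /at_coordinates /=; rewrite -[RHS]mulr1 -(direction_unit S); ring.
Qed.

Lemma coordinatesK S p : at_coordinates S (abscissa S p) (ordinate S p) = p.
Proof.
case: p => x y; rewrite /abscissa /ordinate /at_coordinates /=; congr pair.
  apply/eqP; rewrite -subr_eq0; apply/eqP.
  transitivity ((x - (corner S).1) * ((direction S).1 ^+ 2 + (direction S).2 ^+ 2 - 1)).
    by ring.
  by rewrite direction_unit subrr mulr0.
apply/eqP; rewrite -subr_eq0; apply/eqP.
transitivity ((y - (corner S).2) * ((direction S).1 ^+ 2 + (direction S).2 ^+ 2 - 1)).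
  by ring.
by rewrite direction_unit subrr mulr0.
Qed.

(** The points whose coordinates in the frame of S lie in the box b. *)
Definition box_points S (b : box R) : set (R * R) :=
  [set p | closed_box b (abscissa S p) (ordinate S p)].

Lemma pointsE S : points S = box_points S ((0, width S), (0, height S)).
Proof.
apply/seteqP; split=> p.
  case=> a [b [/andP[a0 aw] /andP[b0 bh] e]].
  have -> : p = at_coordinates S a b by [].
  by rewrite /box_points /= abscissaK ordinateK; apply/and4P.
case/and4P => a0 aw b0 bh; exists (abscissa S p), (ordinate S p).
by split; rewrite ?a0 ?b0 // -[LHS](coordinatesK S).
Qed.

Lemma component_le1 S : `|(direction S).1| <= 1 /\ `|(direction S).2| <= 1.
Proof.
have u := direction_unit S.
have sq (x y : R) : x ^+ 2 + y ^+ 2 = 1 -> `|x| <= 1.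
  move=> e; rewrite -(@ler_pXn2r _ 2) ?nnegrE // real_normK ?num_real // expr1n -e lerDl sqr_ge0 //.
by split; [apply: sq u | apply: (sq _ (direction S).1); rewrite addrC].
Qed.

Lemma coordinates_close S p q e : `|q.1 - p.1| < e -> `|q.2 - p.2| < e ->
  `|abscissa S q - abscissa S p| < 2 * e /\ `|ordinate S q - ordinate S p| < 2 * e.
Proof.
move=> e1 e2; have [u1 u2] := component_le1 S.
have prod (x y : R) : `|x| < e -> `|y| <= 1 -> `|x * y| < e.
  by move=> xe y1; rewrite normrM; apply: le_lt_trans xe; rewrite ler_piMr.
have -> : abscissa S q - abscissa S p =
    (q.1 - p.1) * (direction S).1 + (q.2 - p.2) * (direction S).2 by rewrite /abscissa; ring.
have -> : ordinate S q - ordinate S p =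
    (q.2 - p.2) * (direction S).1 - (q.1 - p.1) * (direction S).2 by rewrite /ordinate; ring.
split; rewrite mulr_natl mulr2n.
  by apply: le_lt_trans (ler_normD _ _) _; rewrite ltrD // prod.
by apply: le_lt_trans (ler_normB _ _) _; rewrite ltrD // prod.
Qed.

Lemma interior_box S b p :
  (box_points S b)° p <->
  [&& b.1.1 < abscissa S p, abscissa S p < b.1.2, b.2.1 < ordinate S p & ordinate S p < b.2.2].
Proof.
rewrite /interior /=; split.
  rewrite nbhs_ballP => -[e /= e0 sub].
  have move_by (x y : R) : `|x| < e / 2 -> `|y| < e / 2 ->
      closed_box b (abscissa S p + x) (ordinate S p + y).
    move=> xe ye.
    have := sub (at_coordinates S (abscissa S p + x) (ordinate S p + y)).
    rewrite /box_points /= abscissaK ordinateK; apply.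
    have [u1 u2] := component_le1 S.
    have prod (z u : R) : `|z| < e / 2 -> `|u| <= 1 -> `|z * u| < e / 2.
      by move=> ze u1'; rewrite normrM; apply: le_lt_trans ze; rewrite ler_piMr.
    have e2 : e = e / 2 + e / 2 by field.
    have := coordinatesK S p; rewrite /at_coordinates.
    case: (p) => p1 p2 [/= h1 h2]; split; rewrite /ball /=.
      rewrite -{1}h1 distrC.
      have -> : forall c a d b' f : R,
          c + (a + x) * d - (b' + y) * f - (c + a * d - b' * f) = x * d - y * f.
        by move=> *; ring.
      by rewrite e2; apply: le_lt_trans (ler_normB _ _) _; rewrite ltrD // prod.
    rewrite -{1}h2 distrC.
    have -> : forall c a d b' f : R,
        c + (a + x) * d + (b' + y) * f - (c + a * d + b' * f) = x * d + y * f.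
      by move=> *; ring.
    by rewrite e2; apply: le_lt_trans (ler_normD _ _) _; rewrite ltrD // prod.
  have e4 : 0 < e / 4 by rewrite divr_gt0.
  have n4 : `|e / 4| < e / 2 by rewrite gtr0_norm //; lra.
  have n4' : `|- (e / 4)| < e / 2 by rewrite normrN.
  have /and4P[_ h2 _ h4] := move_by _ _ n4 n4.
  have /and4P[h1 _ h3 _] := move_by _ _ n4' n4'.
  by apply/and4P; split; lra.
case/and4P => h1 h2 h3 h4; rewrite nbhs_ballP.
have [|e e0 /and5P[e1 e2 e3 e4 _]] := @smaller_than R
  [:: (abscissa S p - b.1.1) / 2; (b.1.2 - abscissa S p) / 2;
      (ordinate S p - b.2.1) / 2; (b.2.2 - ordinate S p) / 2].
  by rewrite /= !divr_gt0 // subr_gt0.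
exists e => //= q [/= q1 q2]; rewrite /ball /= in q1 q2.
have [] := @coordinates_close S p q e; rewrite 1?distrC //.
rewrite !ltr_norml => /andP[? ?] /andP[? ?].
by apply/and4P; split; lra.
Qed.

(** The scalar product and the determinant of the directions of S and A: the cosine and the
sine of the angle from S to A. Their product vanishes exactly when their
sides are parallel. *)
Definition dot S A := (direction S).1 * (direction A).1 + (direction S).2 * (direction A).2.
Definition cross S A := (direction S).1 * (direction A).2 - (direction S).2 * (direction A).1.

Lemma dot_cross_unit S A : dot S A ^+ 2 + cross S A ^+ 2 = 1.
Proof.
rewrite /dot /cross; transitivity (((direction S).1 ^+ 2 + (direction S).2 ^+ 2) *
  ((direction A).1 ^+ 2 + (direction A).2 ^+ 2)); first by ring.
by rewrite !direction_unit mulr1.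
Qed.

Lemma turn_unit A : (- (direction A).2) ^+ 2 + (direction A).1 ^+ 2 = 1.
Proof. by rewrite sqrrN addrC direction_unit. Qed.

(** The same set of points, described from the next corner. *)
Definition turn A : rectangle R :=
  @Rectangle R (at_coordinates A (width A) 0) (- (direction A).2, (direction A).1)
    (height A) (width A) (turn_unit A) (height_gt0 A) (width_gt0 A).

Lemma points_turn A : points (turn A) = points A.
Proof.
have ab p : abscissa (turn A) p = ordinate A p by rewrite /abscissa /ordinate /=; ring.
have or p : ordinate (turn A) p = width A - abscissa A p.
  transitivity (width A * ((direction A).1 ^+ 2 + (direction A).2 ^+ 2) - abscissa A p).
    by rewrite /abscissa /ordinate /=; ring.
  by rewrite direction_unit mulr1.
rewrite !pointsE; apply/seteqP; split=> p; rewrite /box_points /= ab or => /and4P[/= ? ? ? ?];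
  apply/and4P; split=> /=; lra.
Qed.

Lemma dot_turn S A : dot S (turn A) = - cross S A.
Proof. by rewrite /dot /cross /=; ring. Qed.

Lemma cross_turn S A : cross S (turn A) = dot S A.
Proof. by rewrite /dot /cross /=; ring. Qed.

(** Every rectangle can be described with a direction in the first quadrant of S. *)
Lemma first_quadrant S A : exists A',
  [/\ points A' = points A, congruent A A', 0 < dot S A' , 0 <= cross S A' &
      dot S A' * cross S A' = 0 <-> dot S A * cross S A = 0].
Proof.
have same : congruent A A by left.
have rot : congruent A (turn A) by right.
have neg1 (x y : R) : - x * y = 0 <-> x * y = 0.
  by rewrite mulNr; split=> [/eqP|->]; rewrite ?oppr0 // oppr_eq0 => /eqP.
have neg2 (x y : R) : - x * y = 0 <-> y * x = 0 by rewrite [y * x]mulrC.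
have neg3 (x y : R) : x * - y = 0 <-> y * x = 0.
  by rewrite mulrN mulrC -mulNr neg1.
have neg4 (x y : R) : - x * - y = 0 <-> x * y = 0 by rewrite mulrNN.
have du := dot_cross_unit S A.
case: (ltP 0 (dot S A)) => d0.
  case: (leP 0 (cross S A)) => k0; first by exists A.
  exists (turn A); rewrite points_turn dot_turn cross_turn oppr_gt0 k0 (ltW d0).
  by split.
case: (ltP 0 (cross S A)) => k0.
  exists (turn (turn (turn A))); rewrite !points_turn !(dot_turn, cross_turn) opprK k0 oppr_ge0 d0.
  by split.
case: (ltP (dot S A) 0) => d1.
  exists (turn (turn A)); rewrite !points_turn !(dot_turn, cross_turn) oppr_ge0 oppr_gt0 d1 k0.
  by split.
have dz : dot S A = 0 by apply/eqP; rewrite eq_le d0 d1.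
have kz : cross S A < 0.
  rewrite lt_neqAle k0 andbT; apply/eqP => kz; move: du.
  by rewrite dz kz !expr0n addr0 => /eqP; rewrite eq_sym oner_eq0.
exists (turn A); rewrite points_turn dot_turn cross_turn oppr_gt0 kz dz.
by split => //; rewrite !mulr0 mul0r.
Qed.

Lemma abscissa_via S A p : abscissa A p =
  (abscissa S p - abscissa S (corner A)) * dot S A +
  (ordinate S p - ordinate S (corner A)) * cross S A.
Proof.
by rewrite -[LHS]mulr1 -(direction_unit S) /abscissa /ordinate /dot /cross /=; ring.
Qed.

Lemma ordinate_via S A p : ordinate A p =
  (ordinate S p - ordinate S (corner A)) * dot S A -
  (abscissa S p - abscissa S (corner A)) * cross S A.
Proof.
by rewrite -[LHS]mulr1 -(direction_unit S) /abscissa /ordinate /dot /cross /=; ring.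
Qed.

(** A rectangle parallel to S is a box in the frame of S. *)
Lemma aligned_box S A : dot S A * cross S A = 0 -> exists b : box R,
  [/\ b.1.1 < b.1.2, b.2.1 < b.2.2, points A = box_points S b &
    (width A = box_width b /\ height A = box_height b) \/
    (width A = box_height b /\ height A = box_width b)].
Proof.
move=> al; have [A' [pA cA d0 k0 e]] := first_quadrant S A.
have kz : cross S A' = 0.
  by have /eqP := proj2 e al; rewrite mulf_eq0 (gt_eqF d0) /= => /eqP.
have d1 : dot S A' = 1.
  have := dot_cross_unit S A'; rewrite kz expr0n addr0 => /eqP.
  rewrite sqrf_eq1 => /orP[/eqP //|/eqP dn].
  by move: d0; rewrite dn; lra.
set x0 := abscissa S (corner A'); set y0 := ordinate S (corner A').
exists ((x0, x0 + width A'), (y0, y0 + height A')); split.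
- by rewrite /= ltrDl width_gt0.
- by rewrite /= ltrDl height_gt0.
- rewrite -pA pointsE; apply/seteqP; split=> p;
    rewrite /box_points /= (abscissa_via S A') (ordinate_via S A')
    kz d1 !mulr1 !mulr0 subr0 addr0 -/x0 -/y0 => /and4P[/= ? ? ? ?]; apply/and4P; split=> /=; lra.
rewrite /box_width /box_height /= ![_ + width _ - _]addrC ![_ + height _ - _]addrC !addKr.
exact: cA.
Qed.

(** The tiles of a rectangle are parallel to it. *)
Lemma tiles_aligned (I : finType) S (Q : I -> rectangle R) :
  (forall p, points S p <-> exists i, points (Q i) p) ->
  (forall i j, i != j -> (points (Q i))° `&` (points (Q j))° = set0) ->
  forall i, dot S (Q i) * cross S (Q i) = 0.
Proof.
move=> cov dis.
have [T hT] := fin_all_exists (fun i => first_quadrant S (Q i)).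
pose c i := dot S (T i); pose s i := cross S (T i).
pose vx i := abscissa S (corner (T i)); pose vy i := ordinate S (corner (T i)).
have alE i x y : along c s vx vy i x y = abscissa (T i) (at_coordinates S x y).
  by rewrite (abscissa_via S) abscissaK ordinateK.
have beE i x y : across c s vx vy i x y = ordinate (T i) (at_coordinates S x y).
  by rewrite (ordinate_via S) abscissaK ordinateK.
have inE i x y : in_tile c s vx vy (fun i => width (T i)) (fun i => height (T i)) i x y <->
    points (Q i) (at_coordinates S x y).
  by have [<- _ _ _ _] := hT i; rewrite pointsE /in_tile alE beE.
have opE i x y : in_open_tile c s vx vy (fun i => width (T i)) (fun i => height (T i)) i x y <->
    (points (Q i))° (at_coordinates S x y).
  by have [<- _ _ _ _] := hT i; rewrite pointsE interior_box /in_open_tile alE beE.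
move=> i; have [_ _ _ _ <-] := hT i.
suff -> : cross S (T i) = 0 by rewrite mulr0.
apply: (@no_tilt R I (width S) (height S) c s vx vy (fun i => width (T i)) (fun i => height (T i))).
- by move=> j; have [] := hT j.
- by move=> j; have [] := hT j.
- by move=> j; apply: dot_cross_unit.
- by move=> j; apply: width_gt0.
- by move=> j; apply: height_gt0.
- move=> x y /andP[x0 xw] /andP[y0 yh].
  have [j hj] : exists j, points (Q j) (at_coordinates S x y).
    by apply/cov; rewrite pointsE /box_points /= abscissaK ordinateK; apply/and4P.
  by exists j; apply/inE.
- move=> j x y /inE hj.
  have : points S (at_coordinates S x y) by apply/cov; exists j.
  by rewrite pointsE /box_points /= abscissaK ordinateK => /and4P[/= -> -> -> ->].
move=> j k x y jk /opE hj; apply/negP => /opE hk.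
by have := dis j k jk; rewrite -subset0 => /(_ (at_coordinates S x y)); apply; split.
Qed.
End Geometry.

(** * Partitions of the square *)

Section Boxes.
Variables (R : realFieldType) (I : finType) (X : I -> box R).

(** If half-open boxes cover a half-open box, then the closed boxes cover the closed box:
move the point slightly towards the lower left corner of q. *)
Lemma box_closure (K : pred I) (q : box R) : q.1.1 < q.1.2 -> q.2.1 < q.2.2 ->
  (forall x y, half_open q x y -> exists2 i, K i & half_open (X i) x y) ->
  forall x y, closed_box q x y -> exists2 i, K i & closed_box (X i) x y.
Proof.
move=> lr bt cov x y /and4P[x1 x2 y1 y2].
pose a := q.1.1 - x; pose b := q.2.1 - y.
have [||||i [t [_ _ /andP[Ki ci] _]]] := @eventually_pick R I (fun i => K i && closed_box (X i) x y)
  (fun i t => K i && half_open (X i) (x + t * a) (y + t * b)) 1.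
- by [].
- move=> t t0 t1; have [|i Ki hi] := cov (x + t * a) (y + t * b).
    have between (l r z : R) : l < r -> l <= z -> z <= r -> l <= z + t * (l - z) < r.
      move=> lr' lz zr; apply/andP; split; first by nra.
      have [->|zr'] := eqVneq z r; first by nra.
      have {zr'}zr : z < r by rewrite lt_neqAle zr' zr.
      by apply: le_lt_trans zr; nra.
    rewrite /half_open; have /andP[-> ->] := between _ _ _ lr x1 x2.
    by have /andP[-> ->] := between _ _ _ bt y1 y2.
  by exists i; rewrite Ki.
- move=> i /negP; rewrite negb_and => /orP[nK|].
    by exists 1 => // t _ _; rewrite (negbTE nK).
  rewrite /closed_box !negb_and -!ltNge => /or4P[] neg.
  + have [|e e0 he] := @negative_affine R (x - (X i).1.1) a; first by rewrite subr_lt0.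
    by exists e => // t t0 te /andP[_ /and4P[+ _ _ _]]; have := he t t0 te; lra.
  + have [|e e0 he] := @negative_affine R ((X i).1.2 - x) (- a); first by rewrite subr_lt0.
    by exists e => // t t0 te /andP[_ /and4P[_ + _ _]]; have := he t t0 te; lra.
  + have [|e e0 he] := @negative_affine R (y - (X i).2.1) b; first by rewrite subr_lt0.
    by exists e => // t t0 te /andP[_ /and4P[_ _ + _]]; have := he t t0 te; lra.
  + have [|e e0 he] := @negative_affine R ((X i).2.2 - y) (- b); first by rewrite subr_lt0.
    by exists e => // t t0 te /andP[_ /and4P[_ _ _ +]]; have := he t t0 te; lra.
- by move=> i; case: (_ && _); [left|right].
by exists i.
Qed.

(** Conversely, move the point slightly up and to the right. *)
Lemma half_open_cover (W : R) : (forall i, within W W (X i)) ->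
  (forall x y, 0 <= x <= W -> 0 <= y <= W -> exists i, closed_box (X i) x y) ->
  forall x y, 0 <= x < W -> 0 <= y < W -> exists i, half_open (X i) x y.
Proof.
move=> wX cov x y /andP[x0 xW] /andP[y0 yW].
have [|e e0 /and3P[ex ey _]] := @smaller_than R [:: W - x; W - y].
  by rewrite /= !subr_gt0 xW yW.
have [||||i [t [_ _ hi _]]] := @eventually_pick R I (fun i => half_open (X i) x y)
  (fun i t => closed_box (X i) (x + t * 1) (y + t * 1)) e; last by exists i.
- by [].
- by move=> t t0 te; apply: cov; apply/andP; split; lra.
- move=> i /negP; rewrite /half_open !negb_and -!ltNge -!leNgt => /or4P[] neg.
  + have [|d d0 he] := @negative_affine R (x - (X i).1.1) 1; first by rewrite subr_lt0.
    by exists d => // t t0 te /and4P[+ _ _ _]; have := he t t0 te; lra.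
  + by exists 1 => // t t0 _ /and4P[_ + _ _]; lra.
  + have [|d d0 he] := @negative_affine R (y - (X i).2.1) 1; first by rewrite subr_lt0.
    by exists d => // t t0 te /and4P[_ _ + _]; have := he t t0 te; lra.
  + by exists 1 => // t t0 _ /and4P[_ _ _ +]; lra.
by move=> i; case: (half_open _ _ _); [left|right].
Qed.
End Boxes.

Section Main.
Variables (R : realType) (S : rectangle R).
Hypothesis hS : is_square S.
Let W := width S.
Let W0 : 0 < W := width_gt0 S.
Let hW : height S = W. Proof. by rewrite -hS. Qed.

Lemma square_points : points S = box_points S ((0, W), (0, W)).
Proof. by rewrite pointsE hW. Qed.

Lemma box_points_at (b : box R) x y : box_points S b (at_coordinates S x y) = closed_box b x y.
Proof. by rewrite /box_points /= abscissaK ordinateK. Qed.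

Lemma closed_box_sub (q r : box R) : q.1.1 < q.1.2 -> q.2.1 < q.2.2 ->
  (forall x y, closed_box q x y -> closed_box r x y) ->
  [/\ r.1.1 <= q.1.1, q.1.2 <= r.1.2, r.2.1 <= q.2.1 & q.2.2 <= r.2.2].
Proof.
move=> lr bt sub.
have /and4P[? _ ? _] : closed_box r q.1.1 q.2.1 by apply: sub; rewrite /closed_box !lexx !ltW.
have /and4P[_ ? _ ?] : closed_box r q.1.2 q.2.2 by apply: sub; rewrite /closed_box !lexx !ltW.
by [].
Qed.

(** A partition of the square S, seen in the frame of S. *)
Lemma tiles_boxes (P : 'I_8 -> rectangle R) : partition_of S P ->
  exists X : 'I_8 -> box R, [/\ box_tiling W W X,
    forall i, points (P i) = box_points S (X i) &
    forall i, (width (P i) = box_width (X i) /\ height (P i) = box_height (X i)) \/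
              (width (P i) = box_height (X i) /\ height (P i) = box_width (X i))].
Proof.
move=> [cov dis].
have covP p : points S p <-> exists i, points (P i) p.
  by rewrite -cov; split=> [[i _ pi]|[i pi]]; exists i.
have al := tiles_aligned covP dis.
have [X hX] := fin_all_exists (fun i => aligned_box (al i)).
exists X; split=> [|i|i]; last 2 first.
- by have [_ _ ->] := hX i.
- by have [_ _ _] := hX i.
have wX i : within W W (X i).
  have [lr bt pX _] := hX i.
  have [||x y|/= ? ? ? ?] := @closed_box_sub (X i) ((0, W), (0, W)) => //.
    rewrite -!box_points_at -pX -square_points => h; apply/covP; by exists i.
  by apply/and5P; split=> //; apply/andP.
split=> //.
  apply: half_open_cover => // x y /andP[x0 xW] /andP[y0 yW].
  have /covP[i] : points S (at_coordinates S x y).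
    by rewrite square_points box_points_at; apply/and4P.
  by have [_ _ -> _] := hX i; rewrite box_points_at; exists i.
move=> i j ij; apply/negP => /and4P[o1 o2 o3 o4].
have [lri bti pXi _] := hX i; have [lrj btj pXj _] := hX j.
have := dis i j ij; rewrite -subset0 pXi pXj.
have [x [x1 x2 x3 x4]] := common_point lri lrj o1 o2.
have [y [y1 y2 y3 y4]] := common_point bti btj o3 o4.
move=> /(_ (at_coordinates S x y)); apply; split; apply/interior_box;
  by rewrite abscissaK ordinateK; apply/and4P.
Qed.

(** The rectangle of the plane given by a box in the frame of S. *)
Definition sub_rectangle (b : box R) (bw : 0 < box_width b) (bh : 0 < box_height b) :
    rectangle R :=
  @Rectangle R (at_coordinates S b.1.1 b.2.1) (direction S) (box_width b) (box_height b)
    (direction_unit S) bw bh.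

Lemma points_sub_rectangle b bw bh : points (@sub_rectangle b bw bh) = box_points S b.
Proof.
set T := sub_rectangle bw bh.
have d1 : dot S T = 1 by rewrite /dot /= -!expr2 direction_unit.
have k0 : cross S T = 0 by rewrite /cross /= mulrC subrr.
rewrite pointsE; apply/seteqP; split=> p;
  rewrite /box_points /= (abscissa_via S T) (ordinate_via S T)
  d1 k0 !mulr1 !mulr0 addr0 subr0 /= abscissaK ordinateK /box_width /box_height =>
  /and4P[/= ? ? ? ?]; apply/and4P; split=> /=; lra.
Qed.

Lemma merging_improper (P : 'I_8 -> rectangle R) (X : 'I_8 -> box R) :
  box_tiling W W X -> (forall i, points (P i) = box_points S (X i)) ->
  merging W X -> ~ proper_partition S P.
Proof.
move=> tX pX [A [q [cA wq hq]]]; apply.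
have /and5P[q1 q2 q3 q4 /andP[q5 q6]] := wq.
have bw : 0 < box_width q by rewrite subr_gt0.
have bh : 0 < box_height q by rewrite subr_gt0.
exists A; move: cA; rewrite [#|'I_8|]card_ord => cA; split=> //.
exists (sub_rectangle bw bh); rewrite points_sub_rectangle square_points; split.
  by move=> p /and4P[? ? ? ?]; apply/and4P; split=> /=; clear cA; lra.
apply/seteqP; split=> p; last first.
  move=> /(box_closure (X := X) (K := mem A) q2 q5) [x y|i iA hi].
    by rewrite hq => /exists_inP.
  by exists i => //; rewrite pX.
case=> i /= iA; rewrite pX.
have /and5P[_ lr _ _ /andP[bt _]] := withinX tX i.
have sub x y : half_open (X i) x y -> half_open q x y.
  by move=> hi; rewrite hq; apply/exists_inP; exists i.
have /and4P[s1 s2 s3 s4] : half_open q (X i).1.1 (X i).2.1.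
  by apply: sub; rewrite /half_open !lexx lr bt.
have s5 : (X i).1.2 <= q.1.2.
  rewrite leNgt; apply/negP => lt.
  have /and4P[_] : half_open q q.1.2 (X i).2.1.
    by apply: sub; rewrite /half_open lexx lt bt (ltW s2).
  by rewrite ltxx.
have s6 : (X i).2.2 <= q.2.2.
  rewrite leNgt; apply/negP => lt.
  have /and4P[_ _ _] : half_open q (X i).1.1 q.2.2.
    by apply: sub; rewrite /half_open lexx lt lr (ltW s4).
  by rewrite ltxx.
by move=> /and4P[? ? ? ?]; apply/and4P; split=> /=; clear cA; lra.
Qed.

(** The action of the symmetries on coordinates, and its inverse. *)
Definition move_point (g : bool * bool * bool) (v : R * R) : R * R :=
  let x := if g.1.1 then W - v.1 else v.1 in
  let y := if g.1.2 then W - v.2 else v.2 in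
  if g.2 then (y, x) else (x, y).

Definition unmove_point (g : bool * bool * bool) (v : R * R) : R * R :=
  let v' := if g.2 then (v.2, v.1) else v in
  (if g.1.1 then W - v'.1 else v'.1, if g.1.2 then W - v'.2 else v'.2).

Lemma unmove_pointK g : cancel (unmove_point g) (move_point g).
Proof. by case: g => [[[] []] []] [x y]; rewrite /move_point /unmove_point /= ?subKr. Qed.

Lemma closed_box_moved g b v :
  closed_box (moved W g b) (move_point g v).1 (move_point g v).2 = closed_box b v.1 v.2.
Proof.
case: b v => [[l r] [d u]] [x y].
have flip (a c : R) : (W - a <= W - c) = (c <= a) by rewrite lerD2l lerN2.
case: g => [[[] []] []]; rewrite /moved /move_box /flip_interval /move_point /closed_box /= ?flip;
  by do ?[case: (_ <= _) => //=].
Qed.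

Definition symmetry (g : bool * bool * bool) (p : R * R) : R * R :=
  let v := move_point g (abscissa S p, ordinate S p) in at_coordinates S v.1 v.2.

Lemma symmetry_box g b : symmetry g @` box_points S b = box_points S (moved W g b).
Proof.
apply/seteqP; split=> p.
  by case=> q hq <-; rewrite /symmetry box_points_at closed_box_moved.
move=> hp; set v := unmove_point g (abscissa S p, ordinate S p).
exists (at_coordinates S v.1 v.2).
  by rewrite box_points_at -(closed_box_moved g) /v unmove_pointK.
by rewrite /symmetry abscissaK ordinateK -surjective_pairing /v unmove_pointK coordinatesK.
Qed.

Lemma euclidean_distE p q : euclidean_dist p q =
  Num.sqrt ((abscissa S p - abscissa S q) ^+ 2 + (ordinate S p - ordinate S q) ^+ 2).
Proof.
rewrite /euclidean_dist; congr Num.sqrt.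
rewrite -[LHS]mulr1 -(direction_unit S) /abscissa /ordinate; ring.
Qed.

Lemma symmetryP g : symmetry_of S (symmetry g).
Proof.
split=> [p q|].
  rewrite !euclidean_distE /symmetry !abscissaK !ordinateK; congr Num.sqrt.
  by case: g => [[[] []] []]; rewrite /move_point /=; ring.
rewrite square_points symmetry_box; congr box_points.
by case: g => [[[] []] []]; rewrite /moved /move_box /flip_interval /= ?subrr ?subr0.
Qed.

Section Forward.
Variables (m : seq (box nat)) (xs ys : nat -> R).
Hypotheses (sol : solution W m xs ys) (gm : grid_tiled m) (um : unmergeable m).

Let incx : increasing W xs 5. Proof. by case: sol. Qed.
Let incy : increasing W ys 4. Proof. by case: sol. Qed.
Let mb := model_box m xs ys.
Let tX : box_tiling W W mb := model_tiling incx incy gm.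

Lemma model_width_gt0 i : 0 < box_width (mb i).
Proof. by have /and5P[_ + _ _ _] := withinX tX i; rewrite subr_gt0. Qed.
Lemma model_height_gt0 i : 0 < box_height (mb i).
Proof. by have /and5P[_ _ _ _ /andP[+ _]] := withinX tX i; rewrite subr_gt0. Qed.

Definition model_partition (i : 'I_8) : rectangle R :=
  sub_rectangle (model_width_gt0 i) (model_height_gt0 i).

Lemma points_model_partition i : points (model_partition i) = box_points S (mb i).
Proof. exact: points_sub_rectangle. Qed.

Lemma model_disjoint i j : i != j ->
  (points (model_partition i))° `&` (points (model_partition j))° = set0.
Proof.
move=> ij; rewrite -subset0 !points_model_partition => p.
move=> [/interior_box/and4P[? ? ? ?] /interior_box/and4P[? ? ? ?]].
have [_ _ /(_ i j ij) /negP] := tX; apply; apply/and4P; split.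
- by apply: (@lt_trans _ _ (abscissa S p)).
- by apply: (@lt_trans _ _ (abscissa S p)).
- by apply: (@lt_trans _ _ (ordinate S p)).
- by apply: (@lt_trans _ _ (ordinate S p)).
Qed.

Lemma model_partition_proper : proper_perfect_mondrian_partition S model_partition.
Proof.
have wX := withinX tX.
split; first split.
- apply/seteqP; split=> p.
    case=> i _; rewrite points_model_partition square_points => /and4P[? ? ? ?].
    by have /and5P[? ? ? ? /andP[? ?]] := wX i; apply/and4P; split=> /=; lra.
  have cov x y : half_open ((0, W), (0, W)) x y -> exists2 i, predT i & half_open (mb i) x y.
    move=> /and4P[/= x0 xW y0 yW]; have [_ /(_ x y) cov _] := tX.
    by have [||i hi] := cov; [rewrite x0|rewrite y0|exists i].
  rewrite square_points => /(@box_closure R _ mb predT ((0, W), (0, W)) W0 W0 cov)[i _ hi].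
  by exists i => //; rewrite points_model_partition.
- exact: model_disjoint.
- by move=> i j ij; have [_ _ _ /(_ i j ij)] := sol.
- move=> i; rewrite /area /= hW.
  have [_ _ [_ _ _ _ /(_ _ (tile_in gm i))[_ _ e]] _] := sol.
  by rewrite [LHS]e mulrC expr2.
case=> A [cA [B [_ hB]]].
have dis (u v : {i | i \in A}) : u != v ->
    (points (model_partition (val u)))° `&` (points (model_partition (val v)))° = set0.
  by move=> uv; apply: model_disjoint; rewrite (inj_eq val_inj).
have cov p : points B p <-> exists u : {i | i \in A}, points (model_partition (val u)) p.
  rewrite -hB; split=> [[i /= iA pi]|[[i iA] pi]]; last by exists i.
  by exists (exist _ i iA).
have al := tiles_aligned cov dis.
have [i iA] : exists i, i \in A by apply/card_gt0P; case/andP: cA => /ltnW.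
have alB : dot S B * cross S B = 0.
  have := al (exist _ i iA).
  have -> : dot B (model_partition (val (exist (fun i => i \in A) i iA))) = dot S B.
    by rewrite /dot /=; ring.
  have -> : cross B (model_partition (val (exist (fun i => i \in A) i iA))) = - cross S B.
    by rewrite /cross /=; ring.
  by rewrite mulrN => /eqP; rewrite oppr_eq0 => /eqP.
have [q [_ _ pB _]] := aligned_box alB.
apply: (model_unmergeable incx incy gm um cA (q := q)) => x y.
rewrite -box_points_at -pB; split.
  by case/cov=> -[j jA] /=; rewrite points_model_partition box_points_at; exists j.
case=> j jA hj; apply/cov; exists (exist _ j jA).
by rewrite points_model_partition box_points_at.
Qed.
End Forward.

(** An isometry preserves the distance between the opposite corners of a tile, which is at
most the diagonal of the tile that contains their images. *)
Lemma not_same m m' xs ys xs' ys'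
  (sol : solution W m xs ys) (gm : grid_tiled m)
  (sol' : solution W m' xs' ys') (gm' : grid_tiled m') i :
  (forall k, diagonal2 (model_box m' xs' ys' k) < diagonal2 (model_box m xs ys i)) ->
  ~ same_up_to_symmetry S (model_partition sol gm) (model_partition sol' gm').
Proof.
move=> lt [f [[iso _] [s hs]]].
pose b := model_box m xs ys i; pose b' := model_box m' xs' ys' (s i).
have := model_width_gt0 sol gm i; have := model_height_gt0 sol gm i.
rewrite !subr_gt0 => /ltW bt /ltW lr.
have in1 : points (model_partition sol gm i) (at_coordinates S b.1.1 b.2.1).
  by rewrite points_model_partition box_points_at /closed_box !lexx /= lr bt.
have in2 : points (model_partition sol gm i) (at_coordinates S b.1.2 b.2.2).
  by rewrite points_model_partition box_points_at /closed_box !lexx /= lr bt.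
have : points (model_partition sol' gm' (s i)) (f (at_coordinates S b.1.1 b.2.1)).
  by rewrite -hs; exists (at_coordinates S b.1.1 b.2.1).
have : points (model_partition sol' gm' (s i)) (f (at_coordinates S b.1.2 b.2.2)).
  by rewrite -hs; exists (at_coordinates S b.1.2 b.2.2).
rewrite !points_model_partition => /and4P[u1 u2 u3 u4] /and4P[v1 v2 v3 v4].
have := iso (at_coordinates S b.1.2 b.2.2) (at_coordinates S b.1.1 b.2.1).
rewrite !euclidean_distE !abscissaK !ordinateK => /(congr1 (fun z => z ^+ 2)).
rewrite !sqr_sqrtr ?addr_ge0 ?sqr_ge0 // => e.
have := lt (s i); rewrite {2}/diagonal2 /box_width /box_height -/b -e ltNge => /negP; apply.
have sq (c d x y : R) : c <= x -> x <= d -> c <= y -> y <= d ->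
    (x - y) ^+ 2 <= (d - c) ^+ 2.
  move=> *; rewrite -[leLHS]real_normK ?num_real // ler_pXn2r ?nnegrE //; last first.
    by clear e; lra.
  by rewrite ler_norml; clear e; apply/andP; split; lra.
by apply: lerD; apply: sq.
Qed.

(** The sizes of the tiles determine the coordinates, from the walls on. *)
Lemma realised_unique m rx ry xs ys : m \in [:: first_type; second_type] ->
  realised W m rx ry -> realised W m xs ys ->
  {in m, forall q, map_box rx ry q = map_box xs ys q}.
Proof.
move=> mm re re'; have mm' : m \in types by move: mm; rewrite !inE => /orP[] ->; rewrite ?orbT.
have rg := rigid mm' re re'.
have [x0 x5 y0 y4 _] := re; have [x0' x5' y0' y4' _] := re'.
have wd l r b t : quad l r b t \in m ->
    (rx r - rx l = xs r - xs l) /\ (ry t - ry b = ys t - ys b).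
  by move=> qm; have [] := rg _ qm.
suff [ex ey] : (forall s, (s <= 5)%N -> rx s = xs s) /\ (forall s, (s <= 4)%N -> ry s = ys s).
  move=> q qm; have gm : grid_tiled m.
    move: mm; rewrite !inE => /orP[]/eqP ->.
      by case/andP: first_type_grid.
    by case/andP: second_type_grid.
  have /andP[/andP[l1 l2] /andP[l3 l4]] := tile_ranks gm qm.
  have l5 := leq_trans (ltnW l1) l2; have l6 := leq_trans (ltnW l3) l4.
  by rewrite /map_box !ex ?ey.
move: mm; rewrite !inE => /orP[]/eqP em; rewrite em in wd.
  have [a1 _] := wd 0%N 1%N 0%N 3%N isT; have [a2 _] := wd 1%N 2%N 0%N 2%N isT.
  have [_ b1] := wd 2%N 5%N 0%N 1%N isT; have [a3 b2] := wd 2%N 3%N 1%N 2%N isT.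
  have [a4 _] := wd 3%N 4%N 1%N 3%N isT; have [_ b3] := wd 1%N 3%N 2%N 3%N isT.
  clear em wd rg mm' re re' hW.
  by split=> [[|[|[|[|[|[|//]]]]]]|[|[|[|[|[|//]]]]]] _; lra.
have [a1 _] := wd 0%N 1%N 0%N 3%N isT; have [a2 _] := wd 1%N 2%N 1%N 3%N isT.
have [_ b1] := wd 1%N 4%N 0%N 1%N isT; have [a3 b2] := wd 2%N 3%N 2%N 3%N isT.
have [a4 b3] := wd 2%N 4%N 1%N 2%N isT.
clear em wd rg mm' re re' hW.
by split=> [[|[|[|[|[|[|//]]]]]]|[|[|[|[|[|//]]]]]] _; lra.
Qed.

Lemma same_as_model m xs ys (sol : solution W m xs ys) (gm : grid_tiled m)
    (P : 'I_8 -> rectangle R) (X : 'I_8 -> box R) g pi rx ry :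
  m \in [:: first_type; second_type] ->
  (forall i, points (P i) = box_points S (X i)) ->
  uniq pi -> size pi = 8%N -> realised W m rx ry ->
  map (moved W g \o X) pi = map (map_box rx ry) m ->
  same_up_to_symmetry S P (model_partition sol gm).
Proof.
move=> mm pX upi spi re e; exists (symmetry g); split; first exact: symmetryP.
have [_ _ re' _] := sol.
have ipi i : i \in pi.
  have c8 : #|pi| = #|'I_8| by rewrite (card_uniqP upi) spi card_ord.
  by rewrite (subset_cardP c8 (subset_predT _)).
have lt8 i : (index i pi < 8)%N.
  by have := ipi i; rewrite -index_mem => /leq_trans; apply; rewrite spi.
pose f i := Ordinal (lt8 i).
have f_inj : injective f.
  by move=> i j /(congr1 val) /= ij; rewrite -(nth_index i (ipi i)) ij nth_index.
exists (perm f_inj) => i; rewrite permE points_model_partition pX symmetry_box; congr box_points.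
have := congr1 (fun l => nth (X i) l (index i pi)) e.
have sm : size m = 8%N by case/and4P: gm => /eqP.
rewrite (nth_map i) ?spi // nth_index //= (nth_map (quad 0 0 0 0)) ?sm // => ->.
by apply: (realised_unique mm re re'); apply: mem_nth; rewrite sm.
Qed.
End Main.

Theorem proposition4p2 (R : realType) (S : rectangle R) (hS : is_square S) :
  exists P1 P2 : 'I_8 -> rectangle R,
    [/\ proper_perfect_mondrian_partition S P1,
        proper_perfect_mondrian_partition S P2,
        ~ same_up_to_symmetry S P1 P2 &
        forall P : 'I_8 -> rectangle R,
          proper_perfect_mondrian_partition S P ->
          same_up_to_symmetry S P P1 \/ same_up_to_symmetry S P P2].
Proof.
have W0 := width_gt0 S.
have [xs [ys [sol1 diag1]]] := solution_first W0.
have [xs' [ys' [sol2 diag2]]] := solution_second W0.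
have /andP[g1 u1] := first_type_grid; have /andP[g2 u2] := second_type_grid.
exists (model_partition sol1 g1), (model_partition sol2 g2); split.
- exact: model_partition_proper.
- exact: model_partition_proper.
- apply: (not_same (i := ord0)) => k; apply: le_lt_trans (diag2 k) (lt_trans _ diag1).
  by rewrite ltr_pM2r ?exprn_gt0 //; lra.
move=> P [part mond perf prop].
have [X [tX pX sX]] := tiles_boxes hS part.
have areaX i : box_width (X i) * box_height (X i) = width S ^+ 2 / 8%:R.
  have := perf i; rewrite /area -hS => e.
  rewrite expr2 mulrC in e *.
  by case: (sX i) e => -[-> ->]; rewrite 1?[box_height _ * _]mulrC => ->; rewrite mulrC.
have distX i j : i != j -> ~ congruent_boxes (X i) (X j).
  move=> ij c; apply: (mond i j ij); move: c; rewrite /congruent /congruent_boxes.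
  by case: (sX i) => -[-> ->]; case: (sX j) => -[-> ->] [[-> ->]|[-> ->]]; auto.
have nm : ~ merging (width S) X by move=> /(merging_improper hS tX pX).
have [g [m [pi [rx [ry [mm upi spi re e]]]]]] :=
  box_classification W0 (card_ord 8) tX nm areaX distX.
rewrite card_ord in spi.
by move: (mm); rewrite !inE => /orP[]/eqP em; rewrite em in mm re e; [left|right];
  apply: same_as_model mm pX upi spi re e.
Qed.
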